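(* Let $\varrho$ be a pseudo-metric on $\mathbb{R}^d$ with the properties listed in the context, with associated family of balls $\mathcal{B}_\varrho$. Let $0<p<\infty$ and suppose $W:\mathbb{R}^d\to\mathbb{C}^{N\times N}$ is a matrix weight in $\mathbf{A}_p(\mathcal{B}_\varrho)$. Then the following hold. (i) For $x\in\mathbb{C}^N$, the weight $u_x(\cdot):=|W^{1/p}(\cdot)x|^p$ satisfies the doubling condition $$\int_{B_\varrho(y,2r)}u_x(t)\,dt\le C\int_{B_\varrho(y,r)}u_x(t)\,dt,$$ with a constant $C=C([W]_{\mathbf{A}_p(\mathcal{B}_\varrho)})$ independent of $x\in\mathbb{C}^N$, $y\in\mathbb{R}^d$ and $r>0$. (ii) $\|W(t)\|$ satisfies the doubling condition $$\int_{B_\varrho(x,2r)}\|W(t)\|\,dt\le C\int_{B_\varrho(x,r)}\|W(t)\|\,dt,$$ with a constant $C=C([W]_{\mathbf{A}_p(\mathcal{B}_\varrho)})$ independent of $x\in\mathbb{R}^d$ and $r>0$. (iii) In case $1<p<\infty$, with $1/p+1/p'=1$, for $x\in\mathbb{R}^d$ (such that $W(x)$ is positive definite) the weight $v_x(\cdot):=\|W^{1/p}(x)W^{-1/p}(\cdot)\|^{p'}$ satisfies the doubling condition $$\int_{B_\varrho(y,2r)}v_x(t)\,dt\le C\int_{B_\varrho(y,r)}v_x(t)\,dt,$$ with a constant $C=C([W]_{\mathbf{A}_p(\mathcal{B}_\varrho)})$ independent of $x,y\in\mathbb{R}^d$ and $r>0$.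
   Context: Pseudo-metric: $\varrho:\mathbb{R}^d\times\mathbb{R}^d\to[0,\infty)$ is a fixed function such that (1) $\varrho(x,x)=0$; (2) $\varrho(x,y)=\varrho(y,x)$; (3) there is a constant $c$ with $\varrho(x,z)\le c[\varrho(x,y)+\varrho(y,z)]$ for all $x,y,z$; (4) for each open neighborhood $O$ of $x\in\mathbb{R}^d$ there is $\epsilon>0$ with $B_\varrho(x,\epsilon):=\{y\in\mathbb{R}^d:\varrho(x,y)<\epsilon\}\subseteq O$; (5) the balls $B_\varrho(x,r)$ are (Lebesgue) measurable, $|B_\varrho(x,r)|$ is continuous as a function of $r>0$, and there is a constant $c'$ with $|B_\varrho(x,2r)|\le c'|B_\varrho(x,r)|$ for all $x\in\mathbb{R}^d$, $r>0$. Put $\mathcal{B}_\varrho:=\{B_\varrho(x,r):x\in\mathbb{R}^d,r>0\}$. Matrix weights: a matrix weight is a measurable function $W:\mathbb{R}^d\to\mathbb{C}^{N\times N}$ that is strictly positive definite almost everywhere; real powers such as $W^{1/p}(x)$ are taken in the sense of the functional calculus. $|\cdot|$ is the Euclidean norm on $\mathbb{C}^N$ and $\|\cdot\|$ is a fixed matrix norm on $\mathbb{C}^{N\times N}$. Write $\fint_E f:=|E|^{-1}\int_E f$. Matrix Muckenhoupt condition relative to a collection $\mathcal{B}$ of sets: for $0<p\le1$, $$[W]_{\mathbf{A}_p(\mathcal{B})}:=\sup_{E\in\mathcal{B}}\operatorname*{ess\,sup}_{t\in E}\fint_E\|W^{1/p}(x)W^{-1/p}(t)\|^p\,dx,$$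 and for $1<p<\infty$, $1/p+1/p'=1$, $$[W]_{\mathbf{A}_p(\mathcal{B})}:=\sup_{E\in\mathcal{B}}\Big[\fint_E\Big(\fint_E\|W^{1/p}(x)W^{-1/p}(t)\|^{p'}dt\Big)^{p/p'}dx\Big]^{1/p}.$$ $W\in\mathbf{A}_p(\mathcal{B})$ means $[W]_{\mathbf{A}_p(\mathcal{B})}<\infty$. The notation $C([W]_{\mathbf{A}_p(\mathcal{B}_\varrho)})$ means that, for fixed $p,N,d,\varrho$ (and fixed matrix norm), the constant depends on $W$ only through $[W]_{\mathbf{A}_p(\mathcal{B}_\varrho)}$. *)

(* Defs.v *)
From HB Require Import structures.
From mathcomp Require Import all_boot all_order all_algebra.
From mathcomp Require Import complex sesquilinear spectral.
From mathcomp Require Import all_classical all_reals all_analysis.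

Set Implicit Arguments.
Unset Strict Implicit.
Unset Printing Implicit Defensive.

Import Order.TTheory GRing.Theory Num.Theory.
Import numFieldNormedType.Exports.

Local Open Scope classical_set_scope.
Local Open Scope ring_scope.

(* Lebesgue measure on R^n, n = d.+1 >= 1, represented by row vectors: the
   Caratheodory measure of the outer measure defined by countable coverings
   with half-open boxes. Its sigma-algebra is that of all Lebesgue measurable
   sets (not only the Borel sets), so the measure is complete. *)
Section lebesgue_Rn.
Context (R : realType) (d : nat).
Local Notation V := 'rV[R]_d.+1.

Definition box (ab : V * V) : set V :=
  [set x | forall i, ab.1 0 i < x 0 i <= ab.2 0 i].

Definition box_volume (ab : V * V) : R :=
  \prod_i Num.max 0 (ab.2 0 i - ab.1 0 i).

Definition lebesgue_outer (A : set V) : \bar R :=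
  ereal_inf [set (\sum_(k <oo) (box_volume (F k))%:E)%E
            | F in [set F : (V * V)^nat | A `<=` \bigcup_k box (F k)]].

Lemma box_volume_ge0 ab : 0 <= box_volume ab.
Proof. by apply: prodr_ge0 => i _; rewrite le_max lexx. Qed.

Lemma lebesgue_outer_ge0 A : (0 <= lebesgue_outer A)%E.
Proof.
apply: le_ereal_inf_tmp => _ [F _ <-]; apply: nneseries_ge0 => k _ _.
by rewrite lee_fin box_volume_ge0.
Qed.

Lemma lebesgue_outer0 : lebesgue_outer set0 = 0%E.
Proof.
apply/eqP; rewrite eq_le lebesgue_outer_ge0 andbT.
apply: ereal_inf_lbound; exists (fun=> (0, 0)) => //=.
apply: eseries0 => k _ _; rewrite /box_volume (bigD1 ord0)//=.
by rewrite !mxE subrr maxxx mul0r.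
Qed.

Lemma le_lebesgue_outer :
  {homo lebesgue_outer : A B / A `<=` B >-> (A <= B)%E}.
Proof.
move=> A B AB; apply: ereal_inf_le_tmp => _ [F BF <-].
by exists F => //; exact: subset_trans BF.
Qed.

Lemma lebesgue_outer_sigma_subadditive : sigma_subadditive lebesgue_outer.
Proof.
move=> A; have [[i ioo]|] := pselect (exists i, lebesgue_outer (A i) = +oo%E).
  rewrite (eseries_pinfty _ _ ioo) ?leey// => n _.
  by rewrite -ltNye (lt_le_trans _ (lebesgue_outer_ge0 _)).
rewrite -forallNE => Aoo.
suff add2e (e : {posnum R}) : (lebesgue_outer (\bigcup_n A n) <=
    \sum_(i <oo) lebesgue_outer (A i) + e%:num%:E)%E.
  by apply/lee_addgt0Pr => _/posnumP[].
rewrite (le_trans _ (epsilon_trick _ _ _))//; last first.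
  by move=> n; exact: lebesgue_outer_ge0.
pose P n (F : (V * V)^nat) := A n `<=` \bigcup_k box (F k) /\
  (\sum_(k <oo) (box_volume (F k))%:E <=
    lebesgue_outer (A n) + (e%:num / (2 ^ n.+1)%:R)%:E)%E.
have [G PG] : {G : ((V * V)^nat)^nat & forall n, P n (G n)}.
  apply: (@choice _ _ P) => n.
  have An : lebesgue_outer (A n) \is a fin_num.
    by rewrite ge0_fin_numE ?lebesgue_outer_ge0// ltey; exact/eqP/Aoo.
  have en1 : 0 < e%:num / (2 ^ n.+1)%:R by [].
  have [_ [F AF <-] /ltW Fle] := lb_ereal_inf_adherent en1 An.
  by exists F; split.
pose v (ij : nat * nat) := (box_volume (G ij.1 ij.2))%:E.
have v_ge0 ij : (0 <= v ij)%E by rewrite lee_fin box_volume_ge0.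
apply: (@le_trans _ _ (\esum_(ij in setT) v ij)%E).
  apply: ereal_inf_lbound => /=.
  have /card_esym/ppcard_eqP[f] := card_nat2.
  exists (uncurry G \o f).
    move=> t [i _ /((PG i).1)[j _ Bt]].
    by exists (f^-1%FUN (i, j)) => //=; rewrite invK ?inE.
  rewrite (_ : v = fun ij => (box_volume (uncurry G ij))%:E); last first.
    by apply/funext => -[].
  rewrite (reindex_esum [set: nat] _ f)//.
  by rewrite nneseries_esumT// => k; rewrite lee_fin box_volume_ge0.
have -> : (\esum_(ij in setT) v ij =
    \sum_(i <oo) \sum_(j <oo) v (i, j))%E.
  rewrite (_ : setT = setT `*`` (fun=> setT)); last by apply/seteqP; split.
  rewrite -(@esum_esum _ _ _ _ _ (fun i j => v (i, j)))//.
  rewrite nneseries_esumT//; last by move=> i; exact: nneseries_ge0.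
  by apply: eq_esum => i _; rewrite nneseries_esumT.
apply: lee_nneseries => [n _ _|n _]; first exact: nneseries_ge0.
exact: (PG n).2.
Qed.

HB.instance Definition _ := isOuterMeasure.Build R V lebesgue_outer
  lebesgue_outer0 lebesgue_outer_ge0 le_lebesgue_outer
  lebesgue_outer_sigma_subadditive.

Definition lebesgue_space : measurableType _ :=
  caratheodory_type lebesgue_outer.

Definition lebesgue_Rn (A : set lebesgue_space) : \bar R := lebesgue_outer A.

HB.instance Definition _ := isMeasure.Build _ lebesgue_space R lebesgue_Rn
  (@caratheodory_measure0 _ _ lebesgue_outer)
  (@caratheodory_measure_ge0 _ _ lebesgue_outer)
  (@caratheodory_measure_sigma_additive _ _ lebesgue_outer).

End lebesgue_Rn.
Arguments lebesgue_space : clear implicits.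
Arguments lebesgue_Rn {R d}.

Section lebesgue_average.
Context (R : realType) (d : nat).
Implicit Types (E : set 'rV[R]_d.+1) (f : 'rV[R]_d.+1 -> \bar R).
Local Open Scope ereal_scope.

Definition average E f : \bar R :=
  (lebesgue_Rn E)^-1 * \int[lebesgue_Rn]_(x in E) f x.

Definition ess_sup_on E f : \bar R :=
  ereal_inf [set y | {ae lebesgue_Rn, forall x, E x -> f x <= y}].

End lebesgue_average.

Section pseudo_metric.
Context (R : realType) (d : nat).
Local Notation V := 'rV[R]_d.+1.
Implicit Types (rho : V -> V -> R) (x y z : V) (r : R).

Definition rho_ball rho x r : set V := [set y | rho x y < r].

Definition rho_balls rho : set (set V) :=
  [set E | exists x r, 0 < r /\ E = rho_ball rho x r].

Record pseudo_metric rho : Prop := PseudoMetric {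
  pseudo_metric_ge0 : forall x y, 0 <= rho x y ;
  pseudo_metric_refl : forall x, rho x x = 0 ;
  pseudo_metric_sym : forall x y, rho x y = rho y x ;
  pseudo_metric_triangle :
    exists c : R, forall x y z, rho x z <= c * (rho x y + rho y z) ;
  pseudo_metric_nbhs : forall x (O : set V), open O -> O x ->
    exists2 e : R, 0 < e & rho_ball rho x e `<=` O ;
  pseudo_metric_measurable : forall x r, 0 < r ->
    measurable (rho_ball rho x r : set (lebesgue_space R d)) ;
  pseudo_metric_continuous : forall x r, 0 < r ->
    {for r, continuous (fun s => lebesgue_Rn (rho_ball rho x s))} ;
  pseudo_metric_doubling : exists c' : R, forall x r, 0 < r ->
    (lebesgue_Rn (rho_ball rho x (2 * r)) <=
     c'%:E * lebesgue_Rn (rho_ball rho x r))%E }.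

End pseudo_metric.

Section complex_matrices.
Context (R : realType) (N : nat).
Local Open Scope sesquilinear_scope.
Local Notation C := R[i].

Definition cnorm2 (v : 'cV[C]_N) : R :=
  Num.sqrt (\sum_i Normc.normc (v i 0) ^+ 2).

(* An arbitrary norm on the complex vector space of N x N matrices;
   submultiplicativity is not required. *)
Record matrix_norm (nrm : 'M[C]_N -> R) : Prop := MatrixNorm {
  matrix_norm_ge0 : forall A, 0 <= nrm A ;
  matrix_norm_eq0 : forall A, nrm A = 0 -> A = 0 ;
  matrix_normZ : forall (a : C) A, nrm (a *: A) = Normc.normc a * nrm A ;
  matrix_normD : forall A B, nrm (A + B) <= nrm A + nrm B }.

Definition posdefmx (A : 'M[C]_N) : Prop :=
  A \is hermsymmx /\
  forall v : 'cV[C]_N, v != 0 -> 0 < (v ^t* *m A *m v) 0 0.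

(* P^-1 diag(l_i^s) P for a unitary diagonalization A = P^-1 diag(l_i) P; only
   meaningful for positive definite A, whose eigenvalues l_i are real. *)
Definition mxpower (A : 'M[C]_N) (s : R) : 'M[C]_N :=
  invmx (spectralmx A)
  *m diag_mx (map_mx (fun z : C => (complex.Re z `^ s)%:C%C) (spectral_diag A))
  *m spectralmx A.

End complex_matrices.

Section matrix_weights.
Context (R : realType) (d N : nat).
Local Notation V := 'rV[R]_d.+1.
Local Notation M := 'M[R[i]]_N.
Implicit Types (W : V -> M) (nrm : M -> R) (p : R) (B : set (set V)).

Record matrix_weight W : Prop := MatrixWeight {
  matrix_weight_measurable : forall i j,
    measurable_fun [set: lebesgue_space R d]
      (fun t : lebesgue_space R d => complex.Re (W t i j)) /\
    measurable_fun [set: lebesgue_space R d]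
      (fun t : lebesgue_space R d => complex.Im (W t i j)) ;
  matrix_weight_posdef : {ae lebesgue_Rn, forall t, posdefmx (W t)} }.

(* 1 / p + 1 / conj_exponent p = 1 *)
Definition conj_exponent p : R := (1 - p^-1)^-1.

Definition weight_kernel nrm p W (x t : V) : R :=
  nrm (mxpower (W x) p^-1 *m mxpower (W t) (- p^-1)).

Definition muckenhoupt_le1 nrm p B W : \bar R :=
  ereal_sup [set ess_sup_on E (fun t =>
      average E (fun x => (weight_kernel nrm p W x t `^ p)%:E)) | E in B].

Definition muckenhoupt_gt1 nrm p B W : \bar R :=
  let q := conj_exponent p in
  ereal_sup [set (average E (fun x =>
      (average E (fun t => (weight_kernel nrm p W x t `^ q)%:E))
        `^ (p / q)) `^ p^-1)%E | E in B].

Definition muckenhoupt nrm p B W : \bar R :=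
  if p <= 1 then muckenhoupt_le1 nrm p B W else muckenhoupt_gt1 nrm p B W.

Definition matrix_Ap nrm p B W : Prop := (muckenhoupt nrm p B W < +oo)%E.

End matrix_weights.

(* Main.v *)
Require Import Defs.
From mathcomp Require Import all_boot all_order all_algebra.
From mathcomp Require Import complex.
From mathcomp Require Import sesquilinear spectral.
From mathcomp Require Import all_classical all_reals all_analysis.
From mathcomp Require Import measurable_realfun.
From mathcomp Require Import ring lra.

Import Order.TTheory GRing.Theory Num.Theory.
Import numFieldNormedType.Exports.

Set Implicit Arguments.
Unset Strict Implicit.
Unset Printing Implicit Defensive.

Local Open Scope classical_set_scope.
Local Open Scope ring_scope.

(** Why the theorem is true.  Write k(x, t) for the norm of
    W^(1/p)(x) W^(-1/p)(t).  Inserting W^(-1/p)(t) W^(1/p)(t) = 1 shows that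
    each of the three weights is comparable to a power of a function g that
    varies at most as fast as the kernel:
    - g(x) <= c k(x, t) g(t) for g = |W^(1/p) v| and for g = |W|^(1/p), whose
      p-th powers are the weights |W^(1/p) v|^p and |W|;
    - g(t) <= c g(s) k(s, t) for g = |W^(1/p)(x) W^(-1/p)|, whose p'-th power
      is the weight k(x, .)^p'.
    The matrix norm enters only up to constants, so the sum of the moduli of
    the entries (entry_norm) stands for it in g; the two are comparable
    because finite-dimensional spheres are compact.

    Let B be a ball, E the ball of twice the radius.  For p <= 1, integrate
    the p-th power of the inequality over x in E: the essential supremum in
    the A_p constant bounds the integral of k(., t)^p, so the integral of g^p
    over E is at most a constant times |E| g(t)^p for almost every t in E.
    Averaging over t in B finishes the proof (doubling_of_ess_sup).  For
    p > 1 one would integrate over t in B and apply Hoelder.  Since the left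
    side does not depend on t, Chebyshev's inequality suffices
    (reverse_chebyshev): on at least half of B, g is bounded by a multiple of
    its average in L^p (in L^p' for the second kind of g), which gives a lower
    bound for k there.  The mixed norm in the A_p constant then gives
    doubling_of_mixed_norm and, with the roles of the variables exchanged,
    dual_doubling_of_mixed_norm.

    Two measure-theoretic points need care.  Integrals of kernels over one
    variable are not known to be measurable in the other one, so monotonicity
    and homogeneity are proved for the integral of an arbitrary nonnegative
    function, which is a lower integral.  Chebyshev's inequality does need g
    to be measurable, hence W^s to be a measurable function for real s.
    The functions f for which f(W) is measurable form an algebra closed under
    pointwise limits on the positive half-line; it contains the identity,
    hence exponentials of its members by the power series, hence the
    logarithm by Newton's iteration for exp, hence x^s = exp(s ln x)
    (measurable_mxpower).

    Finally, a ball has finite measure: small balls lie in bounded sets, and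
    doubling reaches all radii.  If a ball has measure zero, so has the
    double ball, and the inequalities are trivial. *)

(** * Integrals of nonnegative functions without measurability *)

Section lower_integral.
Context d (T : measurableType d) (R : realType).
Variable mu : {measure set T -> \bar R}.
Local Open Scope ereal_scope.

Import HBNNSimple.

(** A simple function below f, set to 0 on the exceptional null set, is a simple
    function below g with the same integral. *)
Lemma ae_le_lower_integral (D : set T) (f g : T -> \bar R) :
  (forall x, D x -> 0 <= f x) -> (forall x, D x -> 0 <= g x) ->
  {ae mu, forall x, D x -> f x <= g x} ->
  \int[mu]_(x in D) f x <= \int[mu]_(x in D) g x.
Proof.
move=> f0 g0 [N [mN muN fgN]]; rewrite !ge0_integralE//.
apply/ge_ereal_sup => _ [h /= hf <-].
have mNc := measurableC mN.
have hE x : proj_nnsfun h mNc x = (h \_ (~` N)) x by rewrite -mrestrict.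
apply: ereal_sup_ubound; exists (proj_nnsfun h mNc).
  move=> x; rewrite hE patchE.
  have [xN|xN] := boolP (x \in ~` N); last by rewrite erestrict_ge0.
  rewrite (le_trans (hf x))// !patchE; case: ifPn => // /set_mem Dx.
  apply: contrapT => fg; move/set_mem : xN; apply; apply: fgN => /=.
  by move=> /(_ Dx).
have I (k : {nnsfun T >-> R}) : sintegral mu k = \int[mu]_x (k x)%:E.
  by rewrite integral_nnsfun// patch_setT.
rewrite !I; apply: ae_eq_integral => //.
- by apply/measurable_EFinP.
- by apply/measurable_EFinP.
exists N; split => // x /not_implyP[_ hx]; apply: contrapT => Nx; apply: hx.
by congr EFin; apply/esym; rewrite hE patchE mem_set.
Qed.

Lemma le_lower_integral (D : set T) (f g : T -> \bar R) :
  (forall x, D x -> 0 <= f x) -> (forall x, D x -> f x <= g x) ->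
  \int[mu]_(x in D) f x <= \int[mu]_(x in D) g x.
Proof.
move=> f0 fg; apply: ae_le_lower_integral => //.
  by move=> x Dx; exact: le_trans (f0 _ Dx) (fg _ Dx).
by apply: aeW => x; exact: fg.
Qed.

(** Scaling by k sends the simple functions below f to simple functions below
    k f; the converse inequality is the same one for 1 / k. *)
Lemma lower_integralZl (D : set T) (f : T -> \bar R) (k : R) : (0 <= k)%R ->
  (forall x, D x -> 0 <= f x) ->
  \int[mu]_(x in D) (k%:E * f x) = k%:E * \int[mu]_(x in D) f x.
Proof.
rewrite le_eqVlt => /predU1P[<- f0|].
  by rewrite mul0e integral0_eq// => x _; rewrite mul0e.
have half (k' : R) g : (0 < k')%R -> (forall x, D x -> 0 <= g x) ->
    k'%:E * \int[mu]_(x in D) g x <= \int[mu]_(x in D) (k'%:E * g x).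
  move=> k0 g0; rewrite muleC -lee_pdivlMr// [leLHS]ge0_integralE//.
  apply/ge_ereal_sup => _ [h /= hf <-].
  rewrite lee_pdivlMr// muleC -sintegralrM ge0_integralE//; last first.
    by move=> x Dx; rewrite mule_ge0// ?lee_fin ?g0// ltW.
  apply: ereal_sup_ubound => /=; exists (scale_nnsfun h (ltW k0)) => //= x.
  rewrite EFinM; move: (hf x); rewrite !patchE; case: ifPn => xD hx.
    by rewrite lee_pmul2l.
  by rewrite -[leRHS](mule0 k'%:E) lee_pmul2l.
move=> k0 f0; apply/eqP; rewrite eq_le half// andbT.
have := @half k^-1%R (fun x => k%:E * f x).
rewrite invr_gt0 => /(_ k0); have kf0 x : D x -> 0 <= k%:E * f x.
  by move=> Dx; rewrite mule_ge0 ?f0// lee_fin ltW.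
move=> /(_ kf0).
have -> : \int[mu]_(x in D) (k^-1%:E * (k%:E * f x)) = \int[mu]_(x in D) f x.
  by apply: eq_integral => x _; rewrite muleA -EFinM mulVf ?gt_eqF// mul1e.
by rewrite muleC lee_pdivrMr// muleC.
Qed.

End lower_integral.

(** * A substitute for Hoelder's inequality *)

Section chebyshev.
Context d (T : measurableType d) (R : realType).
Variable mu : {measure set T -> \bar R}.
Local Open Scope ereal_scope.

Lemma subset_lower_integral (A B : set T) (f : T -> \bar R) :
  A `<=` B -> (forall x, B x -> 0 <= f x) ->
  \int[mu]_(x in A) f x <= \int[mu]_(x in B) f x.
Proof.
move=> AB f0; rewrite integral_mkcond [leRHS]integral_mkcond.
apply: le_lower_integral => x _.
  by apply: erestrict_ge0 => {}x /AB; exact: f0.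
rewrite !patchE; case: ifPn => [/set_mem/AB/mem_set ->//|_].
by case: ifPn => // /set_mem/f0.
Qed.

(** With phi = g^alpha and psi = k^beta for conjugate exponents alpha, beta this
    and theta = beta / alpha this is Hoelder's inequality for the constant
    a^(1/beta) <= k g, up to a power of 2.  Markov's inequality makes phi at most 2 y / m on a subset of B of
    measure at least m / 2, and there psi is at least a (m / (2 y))^theta.
    Hoelder's inequality itself can fail for the lower integral of a
    nonmeasurable psi against a nonmeasurable phi, so measurability of phi is
    what makes the argument work.  The real bound y, instead of the integral
    itself, avoids products of zero and infinity. *)
Lemma reverse_chebyshev (B : set T) (phi : T -> R) (psi : T -> \bar R)
    (a : \bar R) (theta m y : R) :
  measurable B -> mu B = m%:E -> (0 < m)%R -> (0 <= theta)%R -> (0 < y)%R ->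
  0 <= a ->
  (forall t, 0 <= phi t)%R -> measurable_fun B phi ->
  (forall t, B t -> 0 <= psi t) ->
  (forall t, B t -> a <= psi t * (phi t `^ theta)%:E) ->
  \int[mu]_(t in B) (phi t)%:E <= y%:E ->
  a * ((m / 2) `^ (1 + theta))%:E <= (y `^ theta)%:E * \int[mu]_(t in B) psi t.
Proof.
move=> mB Bm m0 th0 y0 a0 phi0 mphi psi0 apsi phiy.
have l0 : (0 < 2 * y / m)%R by rewrite divr_gt0// mulr_gt0.
set l := (2 * y / m)%R in l0.
(* S' is the part of B where phi is large, S the rest of B. *)
pose S' := B `&` [set t | l%:E <= `|(phi t)%:E|].
have mphiE : measurable_fun B (EFin \o phi) by exact/measurable_EFinP.
have mS' : measurable S'.
  by apply: emeasurable_fun_c_infty => //; exact: measurableT_comp.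
have S'le : mu S' <= (m / 2)%:E.
  have := le_integral_abse mu mB mphiE l0; rewrite -/S' => h.
  have {h} : l%:E * mu S' <= y%:E.
    apply: le_trans h (le_trans _ phiy); apply: le_lower_integral => // t _.
    by rewrite /= ger0_norm.
  rewrite muleC -lee_pdivlMr// => /le_trans; apply; rewrite lee_fin /l.
  by rewrite le_eqVlt; apply/orP; left; apply/eqP; field; rewrite !gt_eqF.
pose S := B `\` S'.
have mS : measurable S by exact: measurableD.
have SB : S `<=` B by move=> t [].
have Sge : (m / 2)%:E <= mu S.
  have S'f : mu S' \is a fin_num by rewrite ge0_fin_numE// (le_lt_trans S'le)// ltry.
  have -> : mu S = mu B - mu S'.
    have muBoo : mu B < +oo by rewrite Bm ltry.
    rewrite /S measureD//.
    by congr (_ - mu _); apply/setIidr => t [].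
  rewrite Bm -(fineK S'f) -EFinB lee_fin.
  by move: S'le; rewrite -(fineK S'f) lee_fin; lra.
have K0 : (0 <= l `^ theta)%R by exact: powR_ge0.
have step : a * (m / 2)%:E <= (l `^ theta)%:E * \int[mu]_(t in B) psi t.
  apply: (@le_trans _ _ (a * mu S)); first by rewrite lee_wpmul2l.
  rewrite -integral_cst// -lower_integralZl//.
  apply: (@le_trans _ _ (\int[mu]_(t in S) ((l `^ theta)%:E * psi t))); last first.
    by apply: subset_lower_integral => // t Bt; rewrite mule_ge0// ?lee_fin// psi0.
  apply: le_lower_integral => // t [Bt nS'].
  apply: (le_trans (apsi _ Bt)); rewrite muleC lee_wpmul2r ?psi0// lee_fin.
  apply: ge0_ler_powR => //; rewrite ?nnegrE// ?(ltW l0)//.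
  rewrite leNgt; apply/negP => lphi; apply: nS'; split => //=.
  by rewrite lee_fin ger0_norm// ltW.
have m20 : (0 < m / 2)%R by rewrite divr_gt0.
rewrite powRD; last by rewrite (gt_eqF m20) implybT.
rewrite powRr1 ?(ltW m20)// EFinM muleA.
apply: (@le_trans _ _ ((l `^ theta)%:E * \int[mu]_(t in B) psi t * ((m / 2) `^ theta)%:E)).
  by rewrite lee_wpmul2r// lee_fin powR_ge0.
rewrite muleAC -EFinM -powRM ?(ltW l0) ?(ltW m20)//.
by rewrite (_ : (l * (m / 2) = y)%R)// /l; field; rewrite gt_eqF.
Qed.

Lemma comparable_doubling (E B : set T) (f g : T -> R) (a b C : R) :
  (0 <= a)%R -> (0 <= b)%R -> (0 <= C)%R ->
  (forall x, 0 <= f x)%R -> (forall x, 0 <= g x)%R ->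
  (forall x, f x <= a * g x)%R -> (forall x, g x <= b * f x)%R ->
  \int[mu]_(x in E) (g x)%:E <= C%:E * \int[mu]_(x in B) (g x)%:E ->
  \int[mu]_(x in E) (f x)%:E <= (a * C * b)%:E * \int[mu]_(x in B) (f x)%:E.
Proof.
move=> a0 b0 C0 f0 g0 fg gf dg.
apply: (@le_trans _ _ (a%:E * \int[mu]_(x in E) (g x)%:E)).
  rewrite -lower_integralZl// => [|x _]; last by rewrite lee_fin.
  by apply: le_lower_integral => x _; rewrite ?lee_fin// -EFinM lee_fin.
rewrite !EFinM -!muleA lee_wpmul2l// (le_trans dg)// lee_wpmul2l//.
rewrite -lower_integralZl// => [|x _]; last by rewrite lee_fin.
by apply: le_lower_integral => x _; rewrite ?lee_fin// -EFinM lee_fin.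
Qed.

End chebyshev.

(** * Doubling from kernel bounds *)

Section abstract_doubling.
Context d (T : measurableType d) (R : realType).
Variable mu : {measure set T -> \bar R}.
Local Open Scope ereal_scope.

(** Reduces a bound by a possibly infinite Y to bounds by reals above Y, as
    needed to apply reverse_chebyshev. *)
Lemma le_mul_real_approx (X Y : \bar R) (K : R) : (0 < K)%R -> 0 <= Y ->
  (forall y : R, (0 < y)%R -> Y <= y%:E -> X <= (K * y)%:E) -> X <= K%:E * Y.
Proof.
move=> K0; case: Y => [r r0 h| _ h|//]; last first.
  by rewrite mulry gtr0_sg// mul1e leey.
apply/lee_addgt0Pr => e e0; rewrite lee_fin in r0.
have y0 : (0 < r + e / K)%R by rewrite ltr_wpDl// divr_gt0.
apply: le_trans (h _ y0 _) _; first by rewrite lee_fin lerDl divr_ge0// ltW.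
by rewrite -EFinM -EFinD lee_fin mulrDr mulrCA divff ?gt_eqF// mulr1.
Qed.

Variables (E B N : set T) (m M kappa : R).
Hypotheses (mE : measurable E) (mB : measurable B) (mN : measurable N).
Hypotheses (N0 : mu N = 0) (BE : B `<=` E).
Hypotheses (muB : mu B = m%:E) (muE : mu E = M%:E) (m_gt0 : (0 < m)%R).
Hypothesis M_le : (M <= kappa * m)%R.
Variables (k : T -> T -> R) (A c : R).
Hypotheses (k_ge0 : forall x t, (0 <= k x t)%R) (A_gt0 : (0 < A)%R).
Hypothesis c_gt0 : (0 < c)%R.
Variable g : T -> R.
Hypothesis g_ge0 : forall x, (0 <= g x)%R.

Let M_gt0 : (0 < M)%R.
Proof.
apply: lt_le_trans m_gt0 _; rewrite -lee_fin -muB -muE.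
by apply: le_measure => //; rewrite inE.
Qed.

Let invM (f : \bar R) : 0 <= f -> f = M%:E * ((mu E)^-1 * f).
Proof.
move=> f0; rewrite muE inver gt_eqF// muleA -EFinM divff ?gt_eqF// mul1e//.
Qed.

Let aeN : {ae mu, forall x, ~ N x}.
Proof. by exists N; split => // x /contrapT. Qed.

Let BN := B `\` N.

Let mBN : measurable BN. Proof. exact: measurableD. Qed.

Let muBN : mu BN = m%:E.
Proof.
have muBoo : mu B < +oo by rewrite muB ltry.
have BN0 : mu (B `&` N) = 0.
  apply/eqP; rewrite -measure_le0 -N0 le_measure ?inE//.
  exact: measurableI.
by rewrite /BN measureD// [X in _ - X]BN0 sube0.
Qed.

(** The essential supremum bounds the integral of k(., t)^p over E for almost
    every t in E, so there I := (integral of g^p over E) is at most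
    c^p A M g(t)^p; integrate this over t in B. *)
Lemma doubling_of_ess_sup (p : R) : (0 < p)%R ->
  (forall x t, ~ N x -> ~ N t -> g x <= c * k x t * g t)%R ->
  {ae mu, forall t, E t ->
     (mu E)^-1 * \int[mu]_(x in E) (k x t `^ p)%:E <= A%:E} ->
  \int[mu]_(x in E) (g x `^ p)%:E <=
  (c `^ p * A * kappa)%:E * \int[mu]_(x in B) (g x `^ p)%:E.
Proof.
move=> p0 gk kA; set I := \int[mu]_(x in E) _.
have cp0 : (0 <= c `^ p * A * M)%R by rewrite !mulr_ge0 ?powR_ge0// ltW.
have key : {ae mu, forall t, B t -> I <= (c `^ p * A * M)%:E * (g t `^ p)%:E}.
  apply: filterS2 kA aeN => t kAt Nt /BE/kAt{}kAt.
  apply: (@le_trans _ _ (\int[mu]_(x in E) ((c `^ p * g t `^ p)%:E * (k x t `^ p)%:E))).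
    apply: ae_le_lower_integral => [x _|x _|].
    - by rewrite lee_fin powR_ge0.
    - by rewrite -EFinM lee_fin !mulr_ge0 ?powR_ge0.
    apply: filterS aeN => x Nx _; rewrite -EFinM lee_fin -!powRM ?mulr_ge0 ?(ltW c_gt0)//.
    apply: ge0_ler_powR; rewrite ?nnegrE ?mulr_ge0 ?(ltW c_gt0) ?(ltW p0)//.
    by rewrite mulrAC gk.
  rewrite lower_integralZl ?mulr_ge0 ?powR_ge0//; last first.
    by move=> x _; rewrite lee_fin powR_ge0.
  have kI0 : 0 <= \int[mu]_(x in E) (k x t `^ p)%:E.
    by apply: integral_ge0 => x _; rewrite lee_fin powR_ge0.
  rewrite (invM kI0).
  rewrite [leRHS](_ : _ = (c `^ p * g t `^ p)%:E * (M%:E * A%:E)); last first.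
    by rewrite -!EFinM; congr EFin; ring.
  by rewrite lee_wpmul2l ?lee_fin ?mulr_ge0 ?powR_ge0// lee_wpmul2l// lee_fin ltW.
have I0 : 0 <= I by apply: integral_ge0 => x _; rewrite lee_fin powR_ge0.
have : I * m%:E <= (c `^ p * A * M)%:E * \int[mu]_(x in B) (g x `^ p)%:E.
  rewrite -muB -integral_cst// -lower_integralZl//; last first.
    by move=> x _; rewrite lee_fin powR_ge0.
  apply: ae_le_lower_integral => // x _.
  by rewrite -EFinM lee_fin !mulr_ge0 ?powR_ge0// ltW.
rewrite -lee_pdivlMr// => /le_trans; apply.
rewrite muleAC -EFinM lee_wpmul2r//.
  by apply: integral_ge0 => x _; rewrite lee_fin powR_ge0.
rewrite lee_fin -!mulrA ler_wpM2l ?powR_ge0// ler_wpM2l ?(ltW A_gt0)//.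
by rewrite ler_pdivrMr.
Qed.

Variables p q : R.
Hypotheses (p_gt0 : (0 < p)%R) (q_gt0 : (0 < q)%R) (pq : (p^-1 + q^-1 = 1)%R).

Let h x := (mu E)^-1 * \int[mu]_(t in E) (k x t `^ q)%:E.

Let h_ge0 x : 0 <= h x.
Proof.
rewrite mule_ge0 ?inve_ge0//; apply: integral_ge0 => t _.
by rewrite lee_fin powR_ge0.
Qed.

Hypothesis kA :
  ((mu E)^-1 * \int[mu]_(x in E) (h x `^ (p / q))) `^ p^-1 <= A%:E.

Let pq1 : (1 + p / q = p)%R.
Proof.
have := congr1 ( *%R p) pq; rewrite mulrDr mulr1 divff ?gt_eqF//.
Qed.

Let qp1 : (1 + q / p = q)%R.
Proof.
have := congr1 ( *%R q) pq; rewrite mulrDr mulr1 divff ?gt_eqF// addrC//.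
Qed.

Let pqK : (p / q * (q / p) = 1)%R.
Proof. by field; rewrite !gt_eqF. Qed.

Let int_h_le : \int[mu]_(x in E) (h x `^ (p / q)) <= (A `^ p * M)%:E.
Proof.
have h0 : 0 <= \int[mu]_(x in E) (h x `^ (p / q)).
  by apply: integral_ge0 => x _; exact: poweR_ge0.
rewrite (invM h0) (mulrC (A `^ p)%R) EFinM lee_wpmul2l ?lee_fin ?(ltW M_gt0)//.
have mh0 : 0 <= (mu E)^-1 * \int[mu]_(x in E) (h x `^ (p / q)).
  by rewrite mule_ge0// inve_ge0.
rewrite -[leLHS]poweRe1// -(mulVf (lt0r_neq0 p_gt0)) poweRrM -poweR_EFin.
apply: gt0_ler_poweR; rewrite ?(ltW p_gt0)// in_itv/= ?poweR_ge0 ?leey//.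
by rewrite lee_fin ltW.
Qed.


Let kappa_gt0 : (0 < kappa)%R.
Proof. by have := lt_le_trans M_gt0 M_le; rewrite pmulr_lgt0. Qed.

Let poweR_mono (r : R) (x y : \bar R) : (0 <= r)%R -> 0 <= x -> x <= y ->
  x `^ r <= y `^ r.
Proof.
move=> r0 x0 xy; apply: gt0_ler_poweR; rewrite ?in_itv/= ?leey ?andbT//.
exact: le_trans xy.
Qed.

Let powRK (r s : R) (x : R) : (s != 0)%R -> ((x `^ s) `^ (r / s) = x `^ r)%R.
Proof. by move=> s0; rewrite -powRrM mulrCA divff// mulr1. Qed.

Let int_k x : \int[mu]_(t in E) (k x t `^ q)%:E = M%:E * h x.
Proof. by apply: invM; apply: integral_ge0 => t _; rewrite lee_fin powR_ge0. Qed.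

Let measurable_gX (r : R) :
  measurable_fun BN g -> measurable_fun BN (fun t => g t `^ r)%R.
Proof.
by move=> mg; apply: (measurableT_comp (measurable_powR r) mg).
Qed.

Let const_le (r : R) : (0 < r)%R ->
  ((c * A * M / (m / 2)) `^ r <= (2 * c * A * kappa) `^ r)%R.
Proof.
move=> r0; have m20 : (0 < m / 2)%R by rewrite divr_gt0.
have cA : (0 < c * A)%R by rewrite mulr_gt0.
apply: ge0_ler_powR; rewrite ?nnegrE ?(ltW r0) ?divr_ge0 ?mulr_ge0 ?(ltW c_gt0)
  ?(ltW A_gt0) ?(ltW M_gt0) ?(ltW m_gt0) ?(ltW kappa_gt0)//.
rewrite ler_pdivrMr//.
rewrite [leRHS](_ : _ = c * A * (kappa * m))%R; last by field.
by rewrite ler_pM2l.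
Qed.

Let MXE (r s : R) : (1 + s = r)%R -> (M `^ r = M * M `^ s)%R.
Proof.
by move=> <-; rewrite powRD ?(gt_eqF M_gt0) ?implybT// powRr1// ltW.
Qed.

Let powRV (x r : R) : (0 <= x)%R -> (x^-1 `^ r = (x `^ r)^-1)%R.
Proof. by move=> x0; rewrite -powR_inv1// -powRrM mulN1r powRN. Qed.

Let pow_combine (y r s u : R) : (1 + s = r)%R -> (0 < u)%R ->
  (y * c `^ r * M `^ s * (A `^ r * M) / u `^ r = (c * A * M / u) `^ r * y)%R.
Proof.
move=> rs u0; rewrite powRM ?invr_ge0 ?mulr_ge0 ?(ltW c_gt0) ?(ltW A_gt0)
  ?(ltW M_gt0) ?(ltW u0)//.
rewrite !powRM ?mulr_ge0 ?(ltW c_gt0) ?(ltW A_gt0) ?(ltW M_gt0)//.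
by rewrite (MXE rs) powRV ?(ltW u0)//; ring.
Qed.

(** Fix x and apply reverse_chebyshev on B to g(x)^q <= c^q k(x, t)^q g(t)^q;
    this bounds g(x)^q by a multiple of the average h(x) of k(x, .)^q over E.  The power p / q of
    that bound is integrated over x in E, where the mixed norm controls
    h^(p / q). *)
Lemma doubling_of_mixed_norm :
  measurable_fun (B `\` N) g ->
  (forall x t, ~ N x -> ~ N t -> g x <= c * k x t * g t)%R ->
  \int[mu]_(x in E) (g x `^ p)%:E <=
  ((2 * c * A * kappa) `^ p)%:E * \int[mu]_(x in B) (g x `^ p)%:E.
Proof.
move=> mg gk; have m20 : (0 < m / 2)%R by rewrite divr_gt0.
have gp0 D : 0 <= \int[mu]_(x in D) (g x `^ p)%:E.
  by apply: integral_ge0 => x _; rewrite lee_fin powR_ge0.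
apply: le_mul_real_approx => // [|y y0 By].
  by rewrite powR_gt0// !mulr_gt0.
have BNy : \int[mu]_(x in BN) (g x `^ p)%:E <= y%:E.
  apply: le_trans By; apply: subset_lower_integral => [x []//|x _].
  by rewrite lee_fin powR_ge0.
have key x : ~ N x -> ((m / 2) `^ p)%:E * (g x `^ p)%:E <=
    (y * c `^ p * M `^ (p / q))%:E * h x `^ (p / q).
  move=> Nx.
  have : (g x `^ q)%:E * ((m / 2) `^ q)%:E <=
      (y `^ (q / p))%:E * ((c `^ q)%:E * (M%:E * h x)).
    rewrite -{2}qp1; apply: le_trans.
      apply: (@reverse_chebyshev _ _ _ mu BN (fun t => g t `^ p)%R
        (fun t => (c `^ q)%:E * (k x t `^ q)%:E) _ (q / p) m y) => //.
      - by rewrite divr_ge0// ltW.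
      - by rewrite lee_fin powR_ge0.
      - by move=> t; exact: powR_ge0.
      - exact: measurable_gX.
      - by move=> t _; rewrite -EFinM lee_fin mulr_ge0// powR_ge0.
      move=> t [_ Nt]; rewrite powRK ?gt_eqF// -!EFinM lee_fin.
      rewrite -!powRM ?mulr_ge0 ?(ltW c_gt0)//.
      by apply: ge0_ler_powR; rewrite ?nnegrE ?mulr_ge0 ?(ltW c_gt0) ?(ltW q_gt0)// gk.
    rewrite lee_wpmul2l ?lee_fin ?powR_ge0// lower_integralZl ?powR_ge0//; last first.
      by move=> t _; rewrite lee_fin powR_ge0.
    rewrite lee_wpmul2l ?lee_fin ?powR_ge0// -int_k.
    apply: subset_lower_integral => [t [/BE]//|t _].
    by rewrite lee_fin powR_ge0.
  move=> /(@poweR_mono (p / q)); rewrite divr_ge0 ?(ltW p_gt0) ?(ltW q_gt0)//.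
  rewrite -!EFinM lee_fin mulr_ge0 ?powR_ge0// => /(_ erefl erefl).
  move: (h x) (h_ge0 x) (m / 2)%R m20 => hx hx0 u u0.
  rewrite !muleA -!EFinM poweRM ?lee_fin ?mulr_ge0 ?powR_ge0 ?(ltW M_gt0)//.
  rewrite !poweR_EFin !powRM ?mulr_ge0 ?powR_ge0 ?(ltW M_gt0) ?(ltW u0)//.
  rewrite !powRK ?gt_eqF// -powRrM mulrC [(q / p * _)%R]mulrC pqK powRr1 ?(ltW y0)//.
have : ((m / 2) `^ p)%:E * \int[mu]_(x in E) (g x `^ p)%:E <=
    (y * c `^ p * M `^ (p / q))%:E * (A `^ p * M)%:E.
  have C0 : (0 <= y * c `^ p * M `^ (p / q))%R.
    by rewrite !mulr_ge0 ?powR_ge0// ltW.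
  apply: le_trans (lee_wpmul2l _ int_h_le); last by rewrite lee_fin.
  rewrite -!lower_integralZl ?powR_ge0//; last 2 first.
  - by move=> x _; rewrite poweR_ge0.
  - by move=> x _; rewrite lee_fin powR_ge0.
  apply: ae_le_lower_integral.
  - by move=> x _; rewrite -EFinM lee_fin mulr_ge0 ?powR_ge0.
  - by move=> x _; rewrite mule_ge0 ?lee_fin ?poweR_ge0.
  - by apply: filterS aeN => x Nx _; exact: key.
rewrite muleC -lee_pdivlMr ?powR_gt0// => /le_trans; apply.
rewrite -!EFinM lee_fin.
rewrite (pow_combine y pq1 m20).
by rewrite ler_wpM2r ?(ltW y0)// const_le.
Qed.

(** Here g(t)^q is first integrated over t in E, which gives
    I <= c^q g(s)^q M h(s) for almost every s; then reverse_chebyshev is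
    applied on B to the power p / q of this inequality. *)
Lemma dual_doubling_of_mixed_norm :
  measurable_fun (B `\` N) g ->
  (forall s t, ~ N s -> ~ N t -> g t <= c * g s * k s t)%R ->
  \int[mu]_(x in E) (g x `^ q)%:E <=
  ((2 * c * A * kappa) `^ q)%:E * \int[mu]_(x in B) (g x `^ q)%:E.
Proof.
move=> mg gk; have m20 : (0 < m / 2)%R by rewrite divr_gt0.
set I := \int[mu]_(x in E) _.
have gq0 D : 0 <= \int[mu]_(x in D) (g x `^ q)%:E.
  by apply: integral_ge0 => x _; rewrite lee_fin powR_ge0.
have I0 : 0 <= I by exact: gq0.
apply: le_mul_real_approx => // [|y y0 By].
  by rewrite powR_gt0// !mulr_gt0.
have BNy : \int[mu]_(x in BN) (g x `^ q)%:E <= y%:E.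
  apply: le_trans By; apply: subset_lower_integral => [x []//|x _].
  by rewrite lee_fin powR_ge0.
have Ile s : ~ N s -> I <= (c `^ q * g s `^ q * M)%:E * h s.
  move=> Ns; rewrite EFinM -muleA -int_k -lower_integralZl ?mulr_ge0 ?powR_ge0//; last first.
    by move=> t _; rewrite lee_fin powR_ge0.
  apply: ae_le_lower_integral => [t _|t _|].
  - by rewrite lee_fin powR_ge0.
  - by rewrite -EFinM lee_fin !mulr_ge0 ?powR_ge0.
  apply: filterS aeN => t Nt _.
  rewrite -EFinM lee_fin -!powRM ?mulr_ge0 ?(ltW c_gt0)//.
  by apply: ge0_ler_powR; rewrite ?nnegrE ?mulr_ge0 ?(ltW c_gt0) ?(ltW q_gt0)// gk.
have pq0 : (0 <= p / q)%R by rewrite divr_ge0 ?(ltW p_gt0) ?(ltW q_gt0).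
have qp0 : (0 <= q / p)%R by rewrite divr_ge0 ?(ltW p_gt0) ?(ltW q_gt0).
have C0 : (0 <= c `^ p * M `^ (p / q))%R by rewrite mulr_ge0 ?powR_ge0.
have key : I `^ (p / q) * ((m / 2) `^ p)%:E <=
    (y `^ (p / q))%:E * ((c `^ p * M `^ (p / q))%:E * (A `^ p * M)%:E).
  rewrite -{2}pq1; apply: le_trans.
    apply: (@reverse_chebyshev _ _ _ mu BN (fun t => g t `^ q)%R
      (fun t => (c `^ p * M `^ (p / q))%:E * h t `^ (p / q)) _ (p / q) m y) => //.
    - exact: poweR_ge0.
    - by move=> t; exact: powR_ge0.
    - exact: measurable_gX.
    - by move=> t _; rewrite mule_ge0 ?poweR_ge0// lee_fin.
    move=> s [_ /Ile/(poweR_mono pq0 I0)]; move: (h s) (h_ge0 s) => hs hs0.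
    rewrite poweRM ?lee_fin ?mulr_ge0 ?powR_ge0 ?(ltW M_gt0)//.
    rewrite !poweR_EFin !powRM ?mulr_ge0 ?powR_ge0 ?(ltW M_gt0)//.
    rewrite !powRK ?gt_eqF// => /le_trans; apply.
    rewrite [leRHS]muleAC -EFinM lee_wpmul2r ?poweR_ge0// lee_fin.
    by rewrite mulrAC.
  rewrite lee_wpmul2l ?lee_fin ?powR_ge0// lower_integralZl//; last first.
    by move=> s _; rewrite poweR_ge0.
  rewrite lee_wpmul2l ?lee_fin// (le_trans _ int_h_le)//.
  by apply: subset_lower_integral => [t [/BE]//|t _]; exact: poweR_ge0.
have := poweR_mono qp0 _ key; rewrite mule_ge0 ?poweR_ge0 ?lee_fin ?powR_ge0//.
move=> /(_ erefl); rewrite poweRM ?poweR_ge0 ?lee_fin ?powR_ge0// -poweRrM pqK poweRe1//.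
rewrite -!EFinM !poweR_EFin.
move: ((2 * c * A * kappa) `^ q)%R (m / 2)%R m20 (const_le q_gt0) => K u u0 uK.
rewrite !powRM ?mulr_ge0 ?powR_ge0 ?(ltW M_gt0)//.
rewrite !powRK ?gt_eqF// -!(powRrM _ (p / q)) pqK !powRr1 ?(ltW M_gt0) ?(ltW y0)//.
rewrite -lee_pdivlMr ?powR_gt0// => /le_trans; apply.
rewrite -EFinM lee_fin.
rewrite [leLHS](_ : _ = y * c `^ q * M `^ (q / p) * (A `^ q * M) / u `^ q)%R;
  last by ring.
by rewrite (pow_combine y qp1 u0) ler_wpM2r ?(ltW y0).
Qed.

End abstract_doubling.

(** * Measures of balls *)

Section rho_balls.
Context (R : realType) (d : nat) (rho : 'rV[R]_d.+1 -> 'rV[R]_d.+1 -> R).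
Hypothesis rho_pm : pseudo_metric rho.

Lemma rho_ballS x r s : r <= s -> rho_ball rho x r `<=` rho_ball rho x s.
Proof. by move=> rs y /= /lt_le_trans; apply. Qed.

Lemma box_lebesgue_outer_lty (ab : 'rV[R]_d.+1 * 'rV[R]_d.+1) :
  (lebesgue_outer (box ab) < +oo)%E.
Proof.
pose F k : 'rV[R]_d.+1 * 'rV[R]_d.+1 := if k is 0%N then ab else (0, 0).
apply: (@le_lt_trans _ _ (\sum_(k <oo) (box_volume (F k))%:E)%E).
  by apply: ereal_inf_lbound; exists F => //= x abx; exists 0%N.
have F0 k : (0 <= (box_volume (F k))%:E)%E by rewrite lee_fin box_volume_ge0.
rewrite (nneseries_split 0 1)// add0n big_nat1 eseries0 ?adde0 ?ltry//.
case=> //= k _ _; rewrite /box_volume (bigD1 ord0)//=.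
by rewrite !mxE subrr maxxx mul0r.
Qed.

(** A small ball lies in a cube, which is covered by a single box; the doubling
    property then propagates finiteness to the radii 2^k e. *)
Lemma rho_ball_lty x r : 0 < r -> (lebesgue_Rn (rho_ball rho x r) < +oo)%E.
Proof.
move=> r0.
have [e e0 eB] : exists2 e : R, 0 < e & rho_ball rho x e `<=` ball x 1.
  have [|e e0 eO] := @pseudo_metric_nbhs _ _ _ rho_pm x (ball x 1)^° (@open_interior _ _).
    exact: nbhsx_ballx.
  by exists e => //; apply: subset_trans eO _; exact: interior_subset.
have ball_lty : (lebesgue_Rn (rho_ball rho x e) < +oo)%E.
  apply: le_lt_trans (box_lebesgue_outer_lty (x - const_mx 1, x + const_mx 1)).
  apply: le_lebesgue_outer => y /eB[_ xy] i.
  have := xy ord0 i; rewrite !mxE /ball/= ltr_distlC => /andP[xy1 xy2].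
  by rewrite xy1 ltW.
have [c' doubling] := pseudo_metric_doubling rho_pm.
have pow_lty k : (lebesgue_Rn (rho_ball rho x (2 ^+ k * e)) < +oo)%E.
  elim: k => [|k ih]; first by rewrite expr0 mul1r.
  rewrite exprS -mulrA; apply: le_lt_trans (doubling _ _ _) _.
    by rewrite mulr_gt0// exprn_gt0.
  have f : lebesgue_Rn (rho_ball rho x (2 ^+ k * e)) \is a fin_num.
    by rewrite ge0_fin_numE.
  by rewrite -(fineK f) -EFinM ltry.
apply: le_lt_trans (pow_lty (Num.bound (r / e))).
apply: le_lebesgue_outer; apply: rho_ballS.
rewrite -ler_pdivrMr//; have re0 : 0 <= r / e by rewrite divr_ge0// ltW.
apply: le_trans (ltW (archi_boundP re0)) _.
by rewrite -natrX ler_nat ltnW// ltn_expl.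
Qed.

End rho_balls.

(** * The entrywise norm of complex matrices *)

Section entry_norm.
Context (R : realType).
Local Notation C := R[i].
Local Notation normc := (@Normc.normc R).

Lemma normc_ge0 (z : C) : 0 <= normc z.
Proof. by case: z => a b; exact: sqrtr_ge0. Qed.

Lemma normc_Complex (a b : R) : normc (Complex a b) <= `|a| + `|b|.
Proof.
rewrite -[leRHS]ger0_norm ?addr_ge0// -sqrtr_sqr ler_wsqrtr// sqrrD.
rewrite !real_normK ?num_real// lerD2r lerDl mulrn_wge0// mulr_ge0//.
Qed.

Lemma normc_sum (I : Type) (s : seq I) (F : I -> C) :
  normc (\sum_(i <- s) F i) <= \sum_(i <- s) normc (F i).
Proof.
elim/big_ind2 : _ => // [|x x' y y' xx' yy'].
  by rewrite Normc.normc0.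
exact: le_trans (le_normcD _ _) (lerD xx' yy').
Qed.

Definition entry_norm m n (A : 'M[C]_(m, n)) : R :=
  \sum_i \sum_j normc (A i j).

Lemma entry_norm_ge0 m n (A : 'M[C]_(m, n)) : 0 <= entry_norm A.
Proof. by rewrite !sumr_ge0// => i _; rewrite sumr_ge0// => j _; exact: normc_ge0. Qed.

Lemma normc_le_entry_norm m n (A : 'M[C]_(m, n)) i j :
  normc (A i j) <= entry_norm A.
Proof.
rewrite /entry_norm (bigD1 i)//= (bigD1 j)//= -addrA lerDl addr_ge0//.
  by rewrite sumr_ge0// => k _; exact: normc_ge0.
by rewrite !sumr_ge0// => k _; rewrite sumr_ge0// => l _; exact: normc_ge0.
Qed.

Lemma entry_normM m n o (A : 'M[C]_(m, n)) (B : 'M[C]_(n, o)) :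
  entry_norm (A *m B) <= entry_norm A * entry_norm B.
Proof.
rewrite /entry_norm mulr_suml; apply: ler_sum => i _.
apply: (@le_trans _ _ (\sum_j \sum_k normc (A i k) * normc (B k j))).
  apply: ler_sum => j _; rewrite mxE; apply: le_trans (normc_sum _ _) _.
  by apply: ler_sum => k _; rewrite Normc.normcM.
rewrite exchange_big/= mulr_suml; apply: ler_sum => k _.
rewrite -mulr_sumr ler_wpM2l ?normc_ge0//.
by rewrite [leRHS](bigD1 k)//= lerDl !sumr_ge0// => l _; rewrite sumr_ge0// => ? _; exact: normc_ge0.
Qed.

Lemma normc_le_cnorm2 n (v : 'cV[C]_n) i : normc (v i 0) <= cnorm2 v.
Proof.
rewrite -[leLHS]ger0_norm ?normc_ge0// -sqrtr_sqr ler_wsqrtr//.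
by rewrite (bigD1 i)//= lerDl sumr_ge0// => j _; rewrite sqr_ge0.
Qed.

Lemma entry_norm_le_cnorm2 n (v : 'cV[C]_n) : entry_norm v <= n%:R * cnorm2 v.
Proof.
rewrite mulr_natl -[X in _ *+ X](card_ord n) -sumr_const.
by apply: ler_sum => i _; rewrite big_ord1 normc_le_cnorm2.
Qed.

Lemma cnorm2_le_entry_norm n (v : 'cV[C]_n) : cnorm2 v <= entry_norm v.
Proof.
rewrite -[leRHS]ger0_norm ?entry_norm_ge0// -sqrtr_sqr ler_wsqrtr//.
rewrite expr2 [X in _ <= X * _]/entry_norm mulr_suml; apply: ler_sum => i _.
by rewrite big_ord1 expr2 ler_wpM2l ?normc_ge0 ?normc_le_entry_norm.
Qed.

End entry_norm.

Section norm_equivalence.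
Context (R : realType) (N : nat).
Local Notation C := R[i].
Local Notation normc := (@Normc.normc R).
Variable nrm : 'M[C]_N.+1 -> R.
Hypothesis nrm_norm : matrix_norm nrm.

Let nrm0 : nrm 0 = 0.
Proof.
by have := matrix_normZ nrm_norm 0 0; rewrite scale0r Normc.normc0 mul0r.
Qed.

Lemma matrix_norm_le_entry_norm :
  exists2 c : R, 0 < c & forall A, nrm A <= c * entry_norm A.
Proof.
pose c := \sum_i \sum_j nrm (delta_mx i j).
have c0 : 0 <= c by rewrite !sumr_ge0// => i _; rewrite sumr_ge0// => j _; exact: matrix_norm_ge0.
have le_c i j : nrm (delta_mx i j) <= c + 1.
  rewrite /c (bigD1 i)//= (bigD1 j)//= -!addrA lerDl !addr_ge0//.
    by rewrite sumr_ge0// => k _; exact: matrix_norm_ge0.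
  by rewrite !sumr_ge0// => k _; rewrite sumr_ge0// => l _; exact: matrix_norm_ge0.
exists (c + 1) => [|A]; first by rewrite ltr_wpDl.
have sumle (I : finType) (F : I -> 'M[C]_N.+1) : nrm (\sum_i F i) <= \sum_i nrm (F i).
  elim/big_ind2 : _ => // [|x x' y y' xx' yy']; first by rewrite nrm0.
  exact: le_trans (matrix_normD nrm_norm _ _) (lerD xx' yy').
rewrite [in leLHS](matrix_sum_delta A) mulr_sumr.
apply: le_trans (sumle _ _) (ler_sum _ _) => i _.
rewrite mulr_sumr; apply: le_trans (sumle _ _) (ler_sum _ _) => j _.
by rewrite (matrix_normZ nrm_norm) mulrC ler_wpM2r ?normc_ge0.
Qed.

(** Coordinates identify complex matrices with real row vectors, where nrm is
    Lipschitz, hence continuous, and does not vanish on the compact unit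
    sphere of the sup norm.  So it has a positive lower bound dl there. *)
Lemma entry_norm_le_matrix_norm :
  exists2 c : R, 0 < c & forall A, entry_norm A <= c * nrm A.
Proof.
have [c c0 nrmc] := matrix_norm_le_entry_norm.
pose n := (N.+1 * N.+1)%N.
(* The first n coordinates are the real parts, the last n the imaginary ones. *)
pose mx (v : 'rV[R]_(n + n)) : 'M[C]_N.+1 := \matrix_(i, j)
  (Complex (v 0 (lshift n (mxvec_index i j))) (v 0 (rshift n (mxvec_index i j)))).
pose K := (N.+1 * N.+1 * 2)%:R : R.
have mxB v w : mx (v - w) = mx v - mx w.
  by apply/matrixP => i j; rewrite !mxE.
have mxZ (a : R) v : mx (a *: v) = (Complex a 0) *: mx v.
  apply/matrixP => i j; rewrite !mxE; apply/eqP; rewrite eq_complex/=.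
  by rewrite !mul0r subr0 addr0 !eqxx.
have mx_surj A : exists v, A = mx v.
  exists (row_mx (mxvec (map_mx (@complex.Re R) A)) (mxvec (map_mx (@complex.Im R) A))).
  apply/matrixP => i j; rewrite !mxE /=.
  rewrite (unsplitK (inl _)) (unsplitK (inr _)) !mxvecE !mxE.
  by case: (A i j).
have le_norm (v : 'rV[R]_(n + n)) k : `|v 0 k| <= `|v : 'rV[R]_(n + n)|.
  rewrite [leRHS]/Num.norm/= mx_normrE.
  exact: (le_bigmax _ (fun ij => `|v ij.1 ij.2|) (0, k)).
have mxle (v : 'rV[R]_(n + n)) : entry_norm (mx v) <= K * `|v|.
  apply: (@le_trans _ _ (\sum_(i < N.+1) \sum_(j < N.+1) (2 * `|v|))).
    apply: ler_sum => i _; apply: ler_sum => j _; rewrite mxE.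
    apply: le_trans (normc_Complex _ _) _; rewrite mulr_natl mulr2n.
    by rewrite lerD ?le_norm.
  by rewrite !sumr_const !card_ord -mulrnA -[leLHS]mulr_natl /K (natrM _ _ 2) mulrA.
pose f v := nrm (mx v).
have fc : continuous f.
  have fL v w : f v - f w <= c * K * `|v - w|.
    have : f v <= f (v - w) + f w.
      by rewrite /f mxB -{1}(subrK (mx w) (mx v)) (matrix_normD nrm_norm).
    rewrite -lerBlDr => /le_trans; apply.
    apply: le_trans (nrmc _) _; rewrite -mulrA ler_pM2l//.
  have cK0 : 0 < c * K by rewrite mulr_gt0// ltr0n.
  move=> v; apply: (proj2 (@cvgrPdist_lt _ R _ (nbhs v) (nbhs_filter v) f (f v))).
  move=> e e0; apply/nbhs_ballP; exists (e / (c * K)) => /=.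
    by rewrite divr_gt0.
  move=> w; rewrite -ball_normE/= => vw.
  apply: le_lt_trans (_ : c * K * `|v - w| < _); last first.
    by rewrite mulrC -ltr_pdivlMr.
  by rewrite ler_norml -lerNl opprB fL andbT distrC fL.
pose S := [set v : 'rV[R]_(n + n) | `|v| = 1].
have cS : compact S.
  apply: bounded_closed_compact.
    exists 1; split; first exact: num_real.
    by move=> x x1 v /= ->; exact: ltW.
  have -> : S = (fun v : 'rV[R]_(n + n) => `|v|) @^-1` [set 1] by [].
  apply: closed_comp => [v _|]; first exact: norm_continuous.
  exact: closed_eq.
have cfS : compact (f @` S).
  by apply: continuous_compact => //; exact: continuous_subspaceT.
have [dl dl0 dlf] : exists2 dl, 0 < dl & forall v, S v -> dl <= f v.
  have clfS : closed (f @` S) by apply: compact_closed => //; exact: Rhausdorff.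
  have fS0 : (~` (f @` S)) 0.
    move=> [v Sv /(matrix_norm_eq0 nrm_norm) mxv0].
    have v0 : v = 0.
      apply/rowP => k; rewrite mxE.
      case: (split_ordP k) => k' ->.
      - case/mxvec_indexP: k' => i j.
        by have /matrixP/(_ i j) := mxv0; rewrite !mxE => -[].
      - case/mxvec_indexP: k' => i j.
        by have /matrixP/(_ i j) := mxv0; rewrite !mxE => -[].
    by move: Sv; rewrite /S/= v0 normr0 => /esym/eqP; rewrite oner_eq0.
  have /open_nbhs_nbhs/nbhs_ballP[e/= e0 eS] : open_nbhs 0 (~` (f @` S)).
    by split => //; exact: closed_openC.
  exists e => // v Sv; rewrite leNgt; apply/negP => fve.
  apply: (eS (f v)); last by exists v.
  by rewrite /ball/= sub0r normrN ger0_norm// /f (matrix_norm_ge0 nrm_norm).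
exists (K / dl).
  by rewrite divr_gt0// ltr0n.
move=> A; have [v ->] := mx_surj A.
have [->|v0] := eqVneq v 0.
  apply: le_trans (mxle 0) _; rewrite normr0 mulr0.
  by rewrite mulr_ge0 ?divr_ge0 ?(matrix_norm_ge0 nrm_norm)// ltW.
have nv0 : 0 < `|v| by rewrite normr_gt0.
apply: le_trans (mxle v) _; rewrite -mulrA ler_wpM2l//.
rewrite mulrC ler_pdivlMr// mulrC -ler_pdivlMr//.
have := dlf (`|v|^-1 *: v); rewrite /S/= normrZ normfV normr_id mulVf ?gt_eqF//.
move=> /(_ erefl); rewrite /f mxZ (matrix_normZ nrm_norm) mulrC.
by rewrite /Normc.normc expr0n/= addr0 sqrtr_sqr ger0_norm// invr_ge0.
Qed.

End norm_equivalence.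

(** * Functional calculus *)

Section similar_diagonal.
Context (F : fieldType) (n : nat).
Implicit Types (P : 'M[F]_n) (u v : 'rV[F]_n).

Definition conj_diag_mx P u : 'M[F]_n := invmx P *m diag_mx u *m P.

Lemma conj_diag_mxE P u i j :
  conj_diag_mx P u i j = \sum_k invmx P i k * u 0 k * P k j.
Proof.
by rewrite mxE; apply: eq_bigr => k _; congr (_ * _); rewrite mul_mx_diag !mxE.
Qed.

Lemma conj_diag_mxM P u v : P \in unitmx ->
  conj_diag_mx P u *m conj_diag_mx P v = conj_diag_mx P (\row_k (u 0 k * v 0 k)).
Proof.
move=> Pu; rewrite /conj_diag_mx -!mulmxA (mulmxA P) mulmxV// mul1mx.
congr (_ *m _); rewrite mulmxA; congr (_ *m _).
by apply/matrixP => i j; rewrite mul_diag_mx !mxE mulrnAr.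
Qed.

Lemma conj_diag_mxDE P u v i j :
  conj_diag_mx P (u + v) i j = conj_diag_mx P u i j + conj_diag_mx P v i j.
Proof. by rewrite /conj_diag_mx linearD mulmxDr mulmxDl mxE. Qed.

Lemma conj_diag_mx_const P c : P \in unitmx ->
  conj_diag_mx P (const_mx c) = c%:M.
Proof.
move=> Pu; rewrite /conj_diag_mx diag_const_mx.
by rewrite mul_mx_scalar -scalemxAl mulVmx// scalemx1.
Qed.

Lemma conj_diag_mxK P u : P \in unitmx ->
  P *m conj_diag_mx P u *m invmx P = diag_mx u.
Proof.
by move=> Pu; rewrite /conj_diag_mx !mulmxA mulmxV// mul1mx mulmxK.
Qed.

End similar_diagonal.

Section diagonal_conjugates.
Context (R : realType) (n : nat).
Local Notation C := R[i].
Local Notation normc := (@Normc.normc R).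
Implicit Types (P : 'M[C]_n) (a b : 'I_n -> R).

(** Real diagonals are the case of Hermitian matrices, where P is unitary and
    a lists the eigenvalues. *)
Definition conj_diag P a : 'M[C]_n := conj_diag_mx P (\row_k (a k)%:C%C).

Lemma conj_diagE P a i j :
  conj_diag P a i j = \sum_k invmx P i k * (a k)%:C%C * P k j.
Proof.
by rewrite /conj_diag conj_diag_mxE; apply: eq_bigr => k _; rewrite mxE.
Qed.

Lemma conj_diagM P a b : P \in unitmx ->
  conj_diag P a *m conj_diag P b = conj_diag P (a \* b).
Proof.
move=> Pu; rewrite /conj_diag.
have -> : (\row_k ((a \* b) k)%:C%C : 'rV[C]_n) =
    \row_k ((\row_k (a k)%:C%C : 'rV[C]_n) 0 k * (\row_k (b k)%:C%C : 'rV[C]_n) 0 k).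
  by apply/rowP => k; rewrite !mxE -rmorphM.
exact: conj_diag_mxM.
Qed.

Lemma conj_diagME P a b i j : P \in unitmx ->
  conj_diag P (a \* b) i j = \sum_k conj_diag P a i k * conj_diag P b k j.
Proof. by move=> Pu; rewrite -(conj_diagM a b Pu) mxE. Qed.

Lemma conj_diagDE P a b i j :
  conj_diag P (a \+ b) i j = conj_diag P a i j + conj_diag P b i j.
Proof.
rewrite /conj_diag.
have -> : (\row_k ((a \+ b) k)%:C%C : 'rV[C]_n) =
    (\row_k (a k)%:C%C : 'rV[C]_n) + (\row_k (b k)%:C%C : 'rV[C]_n).
  by apply/rowP => k; rewrite !mxE -rmorphD.
exact: conj_diag_mxDE.
Qed.

Lemma conj_diag_cst P (c : R) : P \in unitmx ->
  conj_diag P (fun=> c) = (c%:C%C)%:M.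
Proof.
move=> Pu; rewrite /conj_diag.
have -> : \row_(k < n) (c%:C)%C = const_mx (c%:C)%C :> 'rV[C]_n.
  by apply/rowP => k; rewrite !mxE.
exact: conj_diag_mx_const.
Qed.

Lemma conj_diagK P a : P \in unitmx ->
  P *m conj_diag P a *m invmx P = diag_mx (\row_k (a k)%:C%C).
Proof. by move=> Pu; rewrite /conj_diag conj_diag_mxK. Qed.

Lemma normc_real (x : R) : normc x%:C%C = `|x|.
Proof. by rewrite /Normc.normc/= expr0n/= addr0 sqrtr_sqr. Qed.

Lemma normc_unitary_le1 P i j : P \is unitarymx -> normc (P i j) <= 1.
Proof.
move=> /unitarymxP/matrixP/(_ i i); rewrite !mxE eqxx.
under eq_bigr do rewrite !mxE -normCK.
move=> h; have {}h : \sum_k normc (P i k) ^+ 2 = 1.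
  apply: complexI; rewrite rmorph_sum/= -[RHS]h.
  by apply: eq_bigr => k _; rewrite rmorphXn.
rewrite -(ler_pXn2r (_ : 0 < 2)%N) ?nnegrE ?normc_ge0// expr1n -h (bigD1 j)//= lerDl.
by rewrite sumr_ge0// => k _; rewrite sqr_ge0.
Qed.

Lemma normc_invmx_unitary_le1 P i j : P \is unitarymx -> normc (invmx P i j) <= 1.
Proof.
move=> Pu; have -> := invmx_unitary Pu.
apply: normc_unitary_le1.
by rewrite trmxC_unitary.
Qed.

(** P (conj_diag P a) P^-1 has a on its diagonal, and the entries of a unitary
    matrix have modulus at most 1. *)
Lemma diag_le_entry_norm P a k : P \is unitarymx ->
  `|a k| <= entry_norm (conj_diag P a).
Proof.
move=> Pu; have /matrixP/(_ k k) := conj_diagK a (unitarymx_unit Pu).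
rewrite [RHS]mxE mxE [RHS]mulrb eqxx mxE => h.
rewrite -normc_real -h; apply: le_trans (normc_sum _ _) _.
rewrite /entry_norm exchange_big/=; apply: ler_sum => j _.
rewrite Normc.normcM -[leRHS]mulr1 ler_pM ?normc_ge0 ?normc_invmx_unitary_le1//.
rewrite mxE; apply: le_trans (normc_sum _ _) (ler_sum _ _) => i _.
by rewrite Normc.normcM -[leRHS]mul1r ler_wpM2r ?normc_ge0 ?normc_unitary_le1.
Qed.

Lemma entry_norm_conj_diag_le P a : P \is unitarymx ->
  entry_norm (conj_diag P a) <= (n * n)%:R * \sum_k `|a k|.
Proof.
move=> Pu; apply: (@le_trans _ _ (\sum_(i < n) \sum_(j < n) \sum_k `|a k|)).
  apply: ler_sum => i _; apply: ler_sum => j _; rewrite conj_diagE.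
  apply: le_trans (normc_sum _ _) (ler_sum _ _) => k _.
  rewrite !Normc.normcM normc_real -[leRHS]mul1r -[leRHS]mulr1.
  by rewrite !ler_pM ?mulr_ge0 ?normc_ge0 ?normc_invmx_unitary_le1 ?normc_unitary_le1.
by rewrite !sumr_const !card_ord -mulrnA mulr_natl.
Qed.

(** Test positivity on the k-th column of P^-1, an eigenvector for a k. *)
Lemma conj_diag_pos P a k : P \is unitarymx -> posdefmx (conj_diag P a) -> 0 < a k.
Proof.
move=> Pu [_ /(_ (col k (invmx P)))].
have PP := unitarymx_unit Pu.
have colE1 : col k (invmx P) = invmx P *m delta_mx k 0 by rewrite colE.
have c0 : col k (invmx P) != 0.
  apply/eqP => c0; have /matrixP/(_ k 0) : P *m col k (invmx P) = 0 by rewrite c0 mulmx0.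
  by rewrite colE1 mulmxA mulmxV// mul1mx !mxE !eqxx => /eqP; rewrite oner_eq0.
move=> /(_ c0); set x := (X in 0 < X) => x0.
have xE : x = (a k)%:C%C.
  rewrite /x colE1 trmx_mul map_mxM/= invmx_unitary// trmxCK.
  rewrite -(invmx_unitary Pu) trmx_delta map_delta_mx.
  rewrite mulmxA -(mulmxA _ _ (invmx P)) -(mulmxA _ P) mulmxA.
  rewrite -mulmxA (mulmxA P) conj_diagK//.
  by rewrite -rowE -colE !mxE eqxx mulr1n.
by move: x0; rewrite xE ltcR.
Qed.

End diagonal_conjugates.

Section functional_calculus.
Context (R : realType) (n : nat).
Local Notation C := R[i].
Implicit Types (A : 'M[C]_n) (f g : R -> R).

Definition eigval A i : R := complex.Re (spectral_diag A 0 i).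

Definition fmx f A : 'M[C]_n := conj_diag (spectralmx A) (f \o eigval A).

Lemma mxpowerE A s : mxpower A s = fmx (fun x => x `^ s) A.
Proof.
have E : map_mx (fun z : C => (complex.Re z `^ s)%:C%C) (spectral_diag A) =
    \row_k (((fun x => x `^ s) \o eigval A) k)%:C%C.
  by apply/rowP => k; rewrite !mxE.
by rewrite /mxpower E.
Qed.

Lemma eq_fmx f g A : (forall k, f (eigval A k) = g (eigval A k)) ->
  fmx f A = fmx g A.
Proof. by move=> fg; rewrite /fmx; congr conj_diag; apply/funext. Qed.

Lemma fmx_id A : posdefmx A -> fmx id A = A.
Proof.
move=> [Ah _]; have /hermitian_normalmx/orthomx_spectralP := Ah.
have E : spectral_diag A = \row_k ((id \o eigval A) k)%:C%C.
  apply/rowP => k; rewrite !mxE /= RRe_real//.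
  by have /mxOverP -> := hermitian_spectral_diag_real Ah.
by move=> AE; rewrite /fmx /conj_diag -E /conj_diag_mx -AE.
Qed.

Lemma eigval_gt0 A k : posdefmx A -> 0 < eigval A k.
Proof.
move=> Ap; apply: (@conj_diag_pos _ _ (spectralmx A) (eigval A)).
  exact: spectral_unitarymx.
by have := fmx_id Ap; rewrite /fmx => ->.
Qed.

End functional_calculus.

(** * Powers of positive definite matrices *)

Section powers.
Context (R : realType) (n : nat).
Implicit Types A : 'M[R[i]]_n.

Lemma mxpower1 A : posdefmx A -> mxpower A 1 = A.
Proof.
move=> Ap; rewrite mxpowerE -[RHS](fmx_id Ap); apply: eq_fmx => k.
by rewrite powRr1// ltW// eigval_gt0.
Qed.

Lemma mxpowerNK A s : posdefmx A -> mxpower A (- s) *m mxpower A s = 1%:M.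
Proof.
move=> Ap; rewrite !mxpowerE /fmx conj_diagM ?spectral_unit//.
rewrite -(conj_diag_cst 1 (spectral_unit A)); congr conj_diag; apply/funext => k.
by rewrite /= powRN mulVf// gt_eqF// powR_gt0// eigval_gt0.
Qed.

(** The entries of a Hermitian matrix bound each of its eigenvalues and are
    bounded by their sum, and the eigenvalues of A^r are those of A^s raised
    to the power r / s. *)
Lemma entry_norm_mxpower_le A r s : posdefmx A -> s != 0 -> 0 <= r / s ->
  entry_norm (mxpower A r) <= (n * n * n)%:R * entry_norm (mxpower A s) `^ (r / s).
Proof.
move=> Ap s0 rs0; have Pu := spectral_unitarymx A.
rewrite !mxpowerE; apply: le_trans (entry_norm_conj_diag_le _ Pu) _.
rewrite (natrM _ (n * n) n) -mulrA ler_wpM2l// -[X in X%:R * _](card_ord n) mulr_natl -sumr_const.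
apply: ler_sum => k _ /=; rewrite ger0_norm ?powR_ge0//.
have -> : eigval A k `^ r = (eigval A k `^ s) `^ (r / s).
  by rewrite -powRrM mulrCA divff// mulr1.
apply: ge0_ler_powR; rewrite ?nnegrE ?powR_ge0 ?entry_norm_ge0//.
have := diag_le_entry_norm ((fun x => x `^ s) \o eigval A) k Pu.
by rewrite /= ger0_norm ?powR_ge0.
Qed.

End powers.

(** * Measurability of matrix-valued functions *)

Section complex_measurability.
Context d (T : measurableType d) (R : realType) (D : set T).
Local Notation C := R[i].

Definition complex_measurable (f : T -> C) :=
  measurable_fun D (fun t => complex.Re (f t)) /\
  measurable_fun D (fun t => complex.Im (f t)).

Lemma complex_measurable_cst c : complex_measurable (fun=> c).
Proof. by split; exact: measurable_cst. Qed.

Lemma complex_measurableD f g : complex_measurable f -> complex_measurable g ->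
  complex_measurable (fun t => f t + g t).
Proof.
move=> [fr fi] [gr gi]; split.
  apply: eq_measurable_fun (measurable_funD fr gr) => t _ /=.
  by case: (f t) (g t) => ? ? [? ?].
apply: eq_measurable_fun (measurable_funD fi gi) => t _ /=.
by case: (f t) (g t) => ? ? [? ?].
Qed.

Lemma complex_measurableM f g : complex_measurable f -> complex_measurable g ->
  complex_measurable (fun t => f t * g t).
Proof.
move=> [fr fi] [gr gi]; split.
  apply: eq_measurable_fun (measurable_funB (measurable_funM fr gr) (measurable_funM fi gi)) => t _ /=.
  by case: (f t) (g t) => ? ? [? ?].
apply: eq_measurable_fun (measurable_funD (measurable_funM fr gi) (measurable_funM fi gr)) => t _ /=.
by case: (f t) (g t) => ? ? [? ?].
Qed.

Lemma complex_measurable_sum (I : Type) (s : seq I) (F : I -> T -> C) :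
  (forall i, complex_measurable (F i)) ->
  complex_measurable (fun t => \sum_(i <- s) F i t).
Proof.
move=> mF; elim: s => [|i s ih].
  by under eq_fun do rewrite big_nil; exact: complex_measurable_cst.
by under eq_fun do rewrite big_cons; exact: complex_measurableD.
Qed.

Let measurable_sqrt : measurable_fun [set: R] (@Num.sqrt R).
Proof. by apply: continuous_measurable_fun; exact: sqrt_continuous. Qed.

Lemma measurable_normc f : complex_measurable f ->
  measurable_fun D (fun t => Normc.normc (f t)).
Proof.
move=> [fr fi].
have -> : (fun t => Normc.normc (f t)) =
    Num.sqrt \o (fun t => complex.Re (f t) ^+ 2 + complex.Im (f t) ^+ 2).
  by apply/funext => t /=; case: (f t).
apply: (measurableT_comp measurable_sqrt).
exact: measurable_funD (measurable_funX 2 fr) (measurable_funX 2 fi).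
Qed.

Definition mx_measurable m n (F : T -> 'M[C]_(m, n)) :=
  forall i j, complex_measurable (fun t => F t i j).

Lemma mx_measurable_cst m n (A : 'M[C]_(m, n)) : mx_measurable (fun=> A).
Proof. by move=> i j; exact: complex_measurable_cst. Qed.

Lemma mx_measurableM m n o (F : T -> 'M[C]_(m, n)) (G : T -> 'M[C]_(n, o)) :
  mx_measurable F -> mx_measurable G -> mx_measurable (fun t => F t *m G t).
Proof.
move=> mF mG i j; under eq_fun do rewrite mxE.
by apply: complex_measurable_sum => k; exact: complex_measurableM.
Qed.

Lemma measurable_entry_norm m n (F : T -> 'M[C]_(m, n)) :
  mx_measurable F -> measurable_fun D (fun t => entry_norm (F t)).
Proof.
move=> mF; apply: measurable_sum => i; apply: measurable_sum => j.
exact: measurable_normc.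
Qed.

Lemma measurable_cnorm2 n (F : T -> 'cV[C]_n) :
  mx_measurable F -> measurable_fun D (fun t => cnorm2 (F t)).
Proof.
move=> mF; apply: (measurableT_comp measurable_sqrt).
apply: measurable_sum => i; apply: measurable_funX.
exact: measurable_normc.
Qed.

End complex_measurability.

(** Newton's iteration for expR z = x.  As the graph of expR lies
    above its tangents, every iterate after the first is at least ln x, and
    from there the sequence decreases; its limit is a fixed point of the
    iteration, which is ln x.  Starting from
    y 0 = 0, one sequence of functions of x serves all x > 0. *)
Lemma newton_ln_cvg (R : realType) (x : R) (y : nat -> R) : 0 < x ->
  (forall m, y m.+1 = y m - 1 + x * expR (- y m)) -> y @ \oo --> ln x.
Proof.
move=> x0 yS.
have xE m : x * expR (- y m) = expR (ln x - y m).
  by rewrite expRD lnK ?posrE.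
have ge_ln m : ln x <= y m.+1.
  by rewrite yS xE; have := expR_ge1Dx (ln x - y m); lra.
have noninc : nonincreasing_seq (fun m => y m.+1).
  apply/nonincreasing_seqP => m; rewrite [y m.+2]yS xE.
  have : expR (ln x - y m.+1) <= 1 by rewrite -expR0 ler_expR subr_le0.
  by lra.
have [l yl] : exists l : R, (fun m => y m.+1) @ \oo --> l.
  exists (limn (fun m => y m.+1)).
  apply: (@nonincreasing_is_cvgn R) => //.
  by exists (ln x) => _ [m _ <-].
have yl' : y @ \oo --> l by rewrite -(cvg_shiftS y).
suff -> : ln x = l by [].
have : (fun m => y m.+1) @ \oo --> l - 1 + x * expR (- l).
  rewrite (_ : (fun m => _) = (fun m => y m - 1 + x * expR (- y m))); last exact/funext.
  apply: cvgD; first by apply: cvgB => //; exact: cvg_cst.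
  apply: cvgMr; apply: (@cvg_comp _ _ _ (fun m => - y m) expR).
    exact: cvgN yl'.
  exact: continuous_expR.
move=> yl2; have lE : l = l - 1 + x * expR (- l) :> R.
  by apply: cvg_unique yl yl2; exact: Rhausdorff.
have e1 : x * expR (- l) = 1 by lra.
move: e1; rewrite expRN => /divr1_eq ->.
by rewrite expRK.
Qed.

(** * Measurability of powers of a matrix weight *)

Section measurable_calculus.
Context d (T : measurableType d) (R : realType) (D : set T) (n : nat).
Variable W : T -> 'M[R[i]]_n.
Hypothesis mW : mx_measurable D W.
Hypothesis W_posdef : forall t, D t -> posdefmx (W t).

(** The class of f such that f(W) is measurable.  It is closed under the
    operations below, although the diagonalization of W t is an arbitrary
    choice, with no measurability in t. *)
Definition measurable_calculus (f : R -> R) := mx_measurable D (fun t => fmx f (W t)).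

Lemma eq_measurable_calculus f g : (forall x, 0 < x -> f x = g x) ->
  measurable_calculus f -> measurable_calculus g.
Proof.
move=> fg mf i j; have [fr fi] := mf i j.
have fgW t : t \in D -> fmx f (W t) = fmx g (W t).
  by move=> /set_mem/W_posdef Wp; apply: eq_fmx => k; rewrite fg// eigval_gt0.
split.
  by apply: eq_measurable_fun fr => t tD; rewrite fgW.
by apply: eq_measurable_fun fi => t tD; rewrite fgW.
Qed.

Lemma measurable_calculus_cst c : measurable_calculus (fun=> c).
Proof.
rewrite /measurable_calculus (_ : (fun t => _) = fun=> (c%:C%C)%:M); last first.
  by apply/funext => t; exact/conj_diag_cst/spectral_unit.
exact: mx_measurable_cst.
Qed.

Lemma measurable_calculus_id : measurable_calculus id.
Proof.
move=> i j; have [mr mi] := mW i j; split.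
  by apply: eq_measurable_fun mr => t /set_mem/W_posdef/fmx_id ->.
by apply: eq_measurable_fun mi => t /set_mem/W_posdef/fmx_id ->.
Qed.

Lemma measurable_calculusD f g : measurable_calculus f ->
  measurable_calculus g -> measurable_calculus (f \+ g).
Proof.
move=> mf mg i j.
rewrite (_ : (fun t => _) = fun t => fmx f (W t) i j + fmx g (W t) i j).
  exact: complex_measurableD (mf i j) (mg i j).
by apply/funext => t; exact: conj_diagDE.
Qed.

Lemma measurable_calculusM f g : measurable_calculus f ->
  measurable_calculus g -> measurable_calculus (f \* g).
Proof.
move=> mf mg i j.
rewrite (_ : (fun t => _) = fun t => \sum_k fmx f (W t) i k * fmx g (W t) k j).
  by apply: complex_measurable_sum => k; exact: complex_measurableM (mf i k) (mg k j).
by apply/funext => t; exact/conj_diagME/spectral_unit.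
Qed.

(** An entry of f(W t) is linear in the values of f at the eigenvalues, so
    pointwise convergence of functions yields convergence of the entries. *)
Lemma measurable_calculus_cvg (f : nat -> R -> R) g :
  (forall m, measurable_calculus (f m)) ->
  (forall x, 0 < x -> f ^~ x @ \oo --> g x) -> measurable_calculus g.
Proof.
move=> mf fg i j.
have ReE h t : complex.Re (fmx h (W t) i j) = \sum_k h (eigval (W t) k) *
    complex.Re (invmx (spectralmx (W t)) i k * spectralmx (W t) k j).
  rewrite conj_diagE (big_morph (@complex.Re R) (id1 := 0) (op1 := +%R))//; last first.
    by case=> ? ? [].
  apply: eq_bigr => k _ /=; move: (invmx _ i k) (spectralmx _ k j) => [a b] [a' b'] /=.
  ring.
have ImE h t : complex.Im (fmx h (W t) i j) = \sum_k h (eigval (W t) k) *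
    complex.Im (invmx (spectralmx (W t)) i k * spectralmx (W t) k j).
  rewrite conj_diagE (big_morph (@complex.Im R) (id1 := 0) (op1 := +%R))//; last first.
    by case=> ? ? [].
  apply: eq_bigr => k _ /=; move: (invmx _ i k) (spectralmx _ k j) => [a b] [a' b'] /=.
  ring.
have lim t (c : 'I_n -> R) : D t ->
    (fun m => \sum_k f m (eigval (W t) k) * c k) @ \oo -->
    \sum_k g (eigval (W t) k) * c k.
  move=> Dt; apply: cvg_big => [|k _]; first exact: add_continuous.
  apply: cvgMl.
  by apply: fg; apply: eigval_gt0; exact: W_posdef.
split.
- apply: (@eq_measurable_fun _ _ _ _ D (fun t => \sum_k g (eigval (W t) k) *
    complex.Re (invmx (spectralmx (W t)) i k * spectralmx (W t) k j))).
    by move=> t _; exact/esym/ReE.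
  apply: (@measurable_fun_cvg _ _ _ D (fun m t => \sum_k f m (eigval (W t) k) *
    complex.Re (invmx (spectralmx (W t)) i k * spectralmx (W t) k j))).
    by move=> m; apply: eq_measurable_fun (mf m i j).1 => t _; exact: ReE.
  by move=> t; exact: lim.
- apply: (@eq_measurable_fun _ _ _ _ D (fun t => \sum_k g (eigval (W t) k) *
    complex.Im (invmx (spectralmx (W t)) i k * spectralmx (W t) k j))).
    by move=> t _; exact/esym/ImE.
  apply: (@measurable_fun_cvg _ _ _ D (fun m t => \sum_k f m (eigval (W t) k) *
    complex.Im (invmx (spectralmx (W t)) i k * spectralmx (W t) k j))).
    by move=> m; apply: eq_measurable_fun (mf m i j).2 => t _; exact: ImE.
  by move=> t; exact: lim.
Qed.

Lemma measurable_calculus_exp f : measurable_calculus f ->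
  measurable_calculus (fun x => expR (f x)).
Proof.
move=> mf; apply: (@measurable_calculus_cvg (fun m x => series (exp_coeff (f x)) m)).
  elim=> [|m ih].
    rewrite (_ : (fun x => _) = fun=> 0); first exact: measurable_calculus_cst.
    by apply/funext => x; rewrite /series/= big_nil.
  rewrite (_ : (fun x => _) = (fun x => series (exp_coeff (f x)) m) \+
      (fun x => f x ^+ m) \* (fun=> m`!%:R^-1)); last first.
    by apply/funext => x; rewrite seriesS/= addrC.
  apply: (measurable_calculusD ih).
  apply: (measurable_calculusM _ (measurable_calculus_cst _)).
  elim: {ih} m => [|m ih].
    rewrite (_ : (fun x => f x ^+ 0) = fun=> 1); first exact: measurable_calculus_cst.
    by apply/funext => x; rewrite expr0.
  rewrite (_ : (fun x => f x ^+ m.+1) = f \* (fun x => f x ^+ m)); last first.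
    by apply/funext => x; rewrite exprS.
  exact: measurable_calculusM mf ih.
by move=> x _; exact: is_cvg_series_exp_coeff.
Qed.

Lemma measurable_calculus_ln : measurable_calculus (@ln R).
Proof.
pose y := fix y m : R -> R :=
  if m is m'.+1 then fun x => y m' x - 1 + x * expR (- y m' x) else fun=> 0.
apply: (@measurable_calculus_cvg y) => [m|x x0]; last first.
  exact: (newton_ln_cvg x0).
have mN f : measurable_calculus f -> measurable_calculus (fun x => - f x).
  move=> mf; apply: (@eq_measurable_calculus ((fun=> -1) \* f)) => [x _|].
    by rewrite /= mulN1r.
  exact: (measurable_calculusM (measurable_calculus_cst _) mf).
elim: m => [|m ih /=]; first exact: measurable_calculus_cst.
apply: (@measurable_calculusD (fun x => y m x - 1) (fun x => x * expR (- y m x))).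
  exact: (measurable_calculusD ih (measurable_calculus_cst _)).
apply: (@measurable_calculusM id (fun x => expR (- y m x))).
  exact: measurable_calculus_id.
exact/measurable_calculus_exp/mN.
Qed.

Lemma measurable_mxpower s : mx_measurable D (fun t => mxpower (W t) s).
Proof.
under eq_fun do rewrite mxpowerE.
apply: (@eq_measurable_calculus (fun x => expR (s * ln x))) => [x x0|].
  by rewrite /powR gt_eqF.
apply/measurable_calculus_exp/(@measurable_calculusM (fun=> s) (@ln R)).
  exact: measurable_calculus_cst.
exact: measurable_calculus_ln.
Qed.

End measurable_calculus.

(** * Doubling for matrix weights *)

Section weights.
Context (R : realType) (d N : nat).
Local Notation V := 'rV[R]_d.+1.
Local Notation M := 'M[R[i]]_N.+1.
Local Notation mu := (@lebesgue_Rn R d).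

Lemma matrix_weight_regular (W : V -> M) : matrix_weight W ->
  exists Z : set (lebesgue_space R d), [/\ measurable Z, mu Z = 0%E,
    forall t, ~ Z t -> posdefmx (W t) & mx_measurable (~` Z) W].
Proof.
move=> [mW [Z [mZ Z0 posZ]]]; exists Z; split; [exact: mZ|exact: Z0| |].
  by move=> t nZt; apply: contrapT => nW; apply: nZt; exact: posZ.
by move=> i j; have [mr mi] := mW i j; split; exact: measurable_funTS.
Qed.

Variable rho : V -> V -> R.
Hypothesis rho_pm : pseudo_metric rho.
Variable nrm : M -> R.
Hypothesis nrm_norm : matrix_norm nrm.
Variable p : R.
Hypothesis p_gt0 : 0 < p.

Let Ap W := muckenhoupt nrm p (rho_balls rho) W.

(* A real number strictly above m if m < +oo: strictness lets an almost
   everywhere bound be extracted from the infimum that defines the essential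
   supremum. *)
Let A (m : \bar R) : R := `|fine m| + 1.

Let A_gt0 m : 0 < A m. Proof. by rewrite /A ltr_wpDl. Qed.

Let lt_A (m : \bar R) : (m < +oo)%E -> (m < (A m)%:E)%E.
Proof.
case: m => [r _|//|_]; last by rewrite ltNyr.
by rewrite lte_fin /A/= (le_lt_trans (ler_norm r))// ltrDl.
Qed.

Let k_ge0 (W : V -> M) x t : 0 <= weight_kernel nrm p W x t.
Proof. exact: matrix_norm_ge0. Qed.

Lemma muckenhoupt_ess_sup W : p <= 1 -> matrix_Ap nrm p (rho_balls rho) W ->
  forall y r, 0 < r -> {ae mu, forall t, rho_ball rho y r t ->
    (average (rho_ball rho y r)
       (fun x => (weight_kernel nrm p W x t `^ p)%:E) <= (A (Ap W))%:E)%E}.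
Proof.
move=> p1 /lt_A; rewrite -/(Ap W); move: (A _) => a Wa y r r0.
have : (ess_sup_on (rho_ball rho y r) (fun t => average (rho_ball rho y r)
    (fun x => (weight_kernel nrm p W x t `^ p)%:E)) < a%:E)%E.
  apply: le_lt_trans Wa; rewrite /Ap /muckenhoupt p1.
  by apply: ereal_sup_ubound; exists (rho_ball rho y r) => //; exists y, r.
move=> /ereal_inf_lt[z /= [Z [mZ Z0 subZ]] za].
exists Z; split; [exact: mZ|exact: Z0|] => t /= nt; apply: subZ => /= h.
by apply: nt => /h/le_trans; apply; exact: ltW.
Qed.

Lemma muckenhoupt_mixed_norm W : 1 < p -> matrix_Ap nrm p (rho_balls rho) W ->
  forall y r, 0 < r -> (average (rho_ball rho y r) (fun x =>
    (average (rho_ball rho y r)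
       (fun t => (weight_kernel nrm p W x t `^ conj_exponent p)%:E))
    `^ (p / conj_exponent p)) `^ p^-1 <= (A (Ap W))%:E)%E.
Proof.
move=> p1 /lt_A/ltW; rewrite -/(Ap W); move: (A _) => a Wa y r r0.
apply: le_trans Wa; rewrite /Ap /muckenhoupt (leNgt p 1) p1/=.
by apply: ereal_sup_ubound; exists (rho_ball rho y r) => //; exists y, r.
Qed.

(** Either the integrals over the double ball vanish, or both balls have
    positive finite measure with ratio at most kappa. *)
Lemma rho_ball_measures : exists2 kappa : R, 0 < kappa &
  forall y r, 0 < r -> mu (rho_ball rho y (2 * r)) = 0%E \/
  exists m M : R, [/\ mu (rho_ball rho y r) = m%:E,
    mu (rho_ball rho y (2 * r)) = M%:E, 0 < m & M <= kappa * m].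
Proof.
have [c' doubling] := pseudo_metric_doubling rho_pm.
exists (`|c'| + 1) => [|y r r0]; first by rewrite ltr_wpDl.
have r20 : 0 < 2 * r by rewrite mulr_gt0.
have fin s : 0 < s -> mu (rho_ball rho y s) \is a fin_num.
  by move=> s0; rewrite ge0_fin_numE//; exact: rho_ball_lty.
have := doubling y r r0; rewrite -(fineK (fin _ r0)) -(fineK (fin _ r20)).
have m0 : 0 <= fine (mu (rho_ball rho y r)) by rewrite fine_ge0.
have M0 : 0 <= fine (mu (rho_ball rho y (2 * r))) by rewrite fine_ge0.
move: (fine _) (fine _) m0 M0 => M' m m0 M0.
rewrite -EFinM lee_fin; move: m0; rewrite le_eqVlt => /predU1P[<-|m0] Mm.
  by left; congr EFin; apply/eqP; rewrite eq_le M0 andbT -[leRHS](mulr0 c').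
right; exists m, M'; split => //; apply: le_trans Mm _.
rewrite ler_wpM2r ?(ltW m0)//; apply: le_trans (ler_norm _) _.
by rewrite lerDl.
Qed.

Lemma null_doubling (E B : set V) (f : V -> \bar R) K : mu E = 0%E ->
  measurable (E : set (lebesgue_space R d)) ->
  0 <= K -> (forall x, 0 <= f x)%E ->
  (\int[mu]_(x in E) f x <= K%:E * \int[mu]_(x in B) f x)%E.
Proof.
move=> E0 mE K0 f0; apply: (@le_trans _ _ 0%E); last first.
  by rewrite mule_ge0// ?lee_fin//; exact: integral_ge0.
have <- : (\int[mu]_(x in E) (cst 0 x) = 0)%E by exact: integral0.
apply: ae_le_lower_integral => //.
by exists E; split => // x /= /not_implyP[].
Qed.

Let conj_gt0 : 1 < p -> 0 < conj_exponent p.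
Proof. by move=> p1; rewrite invr_gt0 subr_gt0 invf_lt1. Qed.

Let conj_sum : p^-1 + (conj_exponent p)^-1 = 1.
Proof. by rewrite invrK addrC subrK. Qed.

(** The form shared by the weights |W^(1/p) v|^p and |W|.  A null double ball
    is treated apart, as averages over it are meaningless. *)
Lemma kernel_doubling (c : R) : 0 < c ->
  exists2 C : \bar R -> R, (forall m, 0 <= C m) & forall W,
  matrix_Ap nrm p (rho_balls rho) W ->
  forall (Z : set (lebesgue_space R d)) (g : V -> R),
  measurable Z -> mu Z = 0%E -> (forall x, 0 <= g x) ->
  measurable_fun (~` Z) (g : lebesgue_space R d -> R) ->
  (forall x t, ~ Z x -> ~ Z t -> g x <= c * weight_kernel nrm p W x t * g t) ->
  forall y r, 0 < r ->
  (\int[mu]_(x in rho_ball rho y (2 * r)) (g x `^ p)%:E <=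
   (C (Ap W))%:E * \int[mu]_(x in rho_ball rho y r) (g x `^ p)%:E)%E.
Proof.
move=> c0; have [kappa kappa0 balls] := rho_ball_measures.
pose C m := if p <= 1 then c `^ p * A m * kappa else (2 * c * A m * kappa) `^ p.
have C0 m : 0 <= C m.
  by rewrite /C; case: ifP => _; rewrite ?powR_ge0// !mulr_ge0 ?powR_ge0 ?(ltW kappa0) ?(ltW (A_gt0 _)).
exists C => // W WAp Z g mZ Z0 g0 mg gk y r r0.
have r20 : 0 < 2 * r by rewrite mulr_gt0.
have mB := pseudo_metric_measurable rho_pm y r0.
have mE := pseudo_metric_measurable rho_pm y r20.
have BE : rho_ball rho y r `<=` rho_ball rho y (2 * r).
  by apply: rho_ballS; rewrite ler_peMl ?(ltW r0)// ler1n.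
have [E0|[m [M' [muB muE m0 Mm]]]] := balls y r r0.
  by apply: null_doubling => // x; rewrite lee_fin powR_ge0.
rewrite /C; case: (leP p 1) => [p1|p1].
  exact: (doubling_of_ess_sup mE mB mZ Z0 BE muB muE m0 Mm (k_ge0 W)
    (A_gt0 (Ap W)) c0 g0 p_gt0 gk (muckenhoupt_ess_sup p1 WAp y r20)).
apply: (doubling_of_mixed_norm mE mB mZ Z0 BE muB muE m0 Mm (k_ge0 W)
    (A_gt0 (Ap W)) c0 g0 p_gt0 (conj_gt0 p1) conj_sum
    (muckenhoupt_mixed_norm p1 WAp y r20) _ gk).
by apply: measurable_funS mg; [exact: measurableC|move=> x []].
Qed.

Lemma dual_kernel_doubling (c : R) : 0 < c -> 1 < p ->
  exists2 C : \bar R -> R, (forall m, 0 <= C m) & forall W,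
  matrix_Ap nrm p (rho_balls rho) W ->
  forall (Z : set (lebesgue_space R d)) (g : V -> R),
  measurable Z -> mu Z = 0%E -> (forall x, 0 <= g x) ->
  measurable_fun (~` Z) (g : lebesgue_space R d -> R) ->
  (forall s t, ~ Z s -> ~ Z t -> g t <= c * g s * weight_kernel nrm p W s t) ->
  forall y r, 0 < r ->
  (\int[mu]_(x in rho_ball rho y (2 * r)) (g x `^ conj_exponent p)%:E <=
   (C (Ap W))%:E *
     \int[mu]_(x in rho_ball rho y r) (g x `^ conj_exponent p)%:E)%E.
Proof.
move=> c0 p1; have [kappa kappa0 balls] := rho_ball_measures.
pose C m := (2 * c * A m * kappa) `^ conj_exponent p.
have C0 m : 0 <= C m by exact: powR_ge0.
exists C => // W WAp Z g mZ Z0 g0 mg gk y r r0.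
have r20 : 0 < 2 * r by rewrite mulr_gt0.
have mB := pseudo_metric_measurable rho_pm y r0.
have mE := pseudo_metric_measurable rho_pm y r20.
have BE : rho_ball rho y r `<=` rho_ball rho y (2 * r).
  by apply: rho_ballS; rewrite ler_peMl ?(ltW r0)// ler1n.
have [E0|[m [M' [muB muE m0 Mm]]]] := balls y r r0.
  by apply: null_doubling => // x; rewrite lee_fin powR_ge0.
apply: (dual_doubling_of_mixed_norm mE mB mZ Z0 BE muB muE m0 Mm (k_ge0 W)
    (A_gt0 (Ap W)) c0 g0 p_gt0 (conj_gt0 p1) conj_sum
    (muckenhoupt_mixed_norm p1 WAp y r20) _ gk).
by apply: measurable_funS mg; [exact: measurableC|move=> x []].
Qed.

End weights.

(** * Kernel inequalities for the three weights *)

Lemma mulmx_insert (F : fieldType) m n o (P Q : 'M[F]_n) (A : 'M[F]_(m, n))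
    (B : 'M[F]_(n, o)) : P *m Q = 1%:M -> A *m B = A *m P *m (Q *m B).
Proof. by move=> PQ; rewrite mulmxA -(mulmxA A) PQ mulmx1. Qed.

Section kernel_inequalities.
Context (R : realType) (N d : nat).
Local Notation V := 'rV[R]_d.+1.
Local Notation M := 'M[R[i]]_N.+1.
Variables (nrm : M -> R) (c : R).
Hypothesis le_nrm : forall A, entry_norm A <= c * nrm A.
Variables (p : R) (W : V -> M).
Local Notation k := (weight_kernel nrm p W).

Lemma entry_norm_power_le_kernel x t o (B : 'M[R[i]]_(N.+1, o)) : posdefmx (W t) ->
  entry_norm (mxpower (W x) p^-1 *m B) <=
  c * k x t * entry_norm (mxpower (W t) p^-1 *m B).
Proof.
move=> Wt; rewrite (mulmx_insert _ B (mxpowerNK p^-1 Wt)).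
apply: le_trans (entry_normM _ _) _.
by rewrite ler_wpM2r ?entry_norm_ge0.
Qed.

Lemma cnorm2_power_le_kernel x t (v : 'cV[R[i]]_N.+1) :
  0 <= c -> (forall A, 0 <= nrm A) -> posdefmx (W t) ->
  cnorm2 (mxpower (W x) p^-1 *m v) <=
  c * N.+1%:R * k x t * cnorm2 (mxpower (W t) p^-1 *m v).
Proof.
move=> c0 nrm0 Wt; apply: le_trans (cnorm2_le_entry_norm _) _.
apply: le_trans (entry_norm_power_le_kernel x v Wt) _.
rewrite -mulrA -[leRHS]mulrA -mulrA ler_wpM2l// mulrCA ler_wpM2l ?nrm0//.
exact: entry_norm_le_cnorm2.
Qed.

(** W^(1/p) satisfies the kernel inequality by entry_norm_power_le_kernel, and
    entry_norm_mxpower_le compares |W|^(1/p) with |W^(1/p)| at both ends. *)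
Lemma entry_norm_weight_le_kernel x t : 0 < p -> posdefmx (W x) -> posdefmx (W t) ->
  0 <= c -> (forall A, 0 <= nrm A) ->
  entry_norm (W x) `^ p^-1 <=
  ((N.+1 * N.+1 * N.+1)%:R `^ p^-1 * c * (N.+1 * N.+1 * N.+1)%:R) * k x t *
    entry_norm (W t) `^ p^-1.
Proof.
move=> p0 Wx Wt c0 nrm0; set K := (N.+1 * N.+1 * N.+1)%:R.
have pi0 : p^-1 != 0 by rewrite invr_eq0 gt_eqF.
have pV0 : 0 <= p^-1 by rewrite invr_ge0 ltW.
have lex : entry_norm (W x) `^ p^-1 <= K `^ p^-1 * entry_norm (mxpower (W x) p^-1).
  have := entry_norm_mxpower_le (r := 1) Wx pi0; rewrite div1r invrK => /(_ (ltW p0)).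
  rewrite mxpower1// => h.
  have {h} : entry_norm (W x) `^ p^-1 <= (K * entry_norm (mxpower (W x) p^-1) `^ p) `^ p^-1.
    by apply: ge0_ler_powR; rewrite ?nnegrE ?entry_norm_ge0 ?mulr_ge0 ?powR_ge0.
  by rewrite powRM ?powR_ge0// -powRrM divff ?gt_eqF// powRr1 ?entry_norm_ge0.
have le_t : entry_norm (mxpower (W t) p^-1) <= K * entry_norm (W t) `^ p^-1.
  have := entry_norm_mxpower_le (r := p^-1) Wt (oner_neq0 R).
  by rewrite divr1 mxpower1// => /(_ pV0).
have := entry_norm_power_le_kernel x (1%:M : M) Wt; rewrite !mulmx1 => lek.
apply: le_trans lex _; rewrite -!mulrA ler_wpM2l ?powR_ge0//.
apply: le_trans lek _; rewrite -mulrA ler_wpM2l// mulrCA ler_wpM2l//.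
exact: nrm0.
Qed.

Lemma entry_norm_dual_le_kernel (B : M) s t : posdefmx (W s) ->
  entry_norm (B *m mxpower (W t) (- p^-1)) <=
  c * entry_norm (B *m mxpower (W s) (- p^-1)) * k s t.
Proof.
move=> Ws; rewrite (mulmx_insert B _ (mxpowerNK p^-1 Ws)).
apply: le_trans (entry_normM _ _) _.
by rewrite mulrAC [leRHS]mulrC ler_wpM2l ?entry_norm_ge0.
Qed.

End kernel_inequalities.

Theorem lemma3p1 (R : realType) (d N : nat)
    (rho : 'rV[R]_d.+1 -> 'rV[R]_d.+1 -> R) (rho_pm : pseudo_metric rho)
    (nrm : 'M[R[i]]_N.+1 -> R) (nrm_norm : matrix_norm nrm)
    (p : R) (p_gt0 : 0 < p) :
  (exists C : \bar R -> R, forall W : 'rV[R]_d.+1 -> 'M[R[i]]_N.+1,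
    matrix_weight W -> matrix_Ap nrm p (rho_balls rho) W ->
    forall (x : 'cV[R[i]]_N.+1) (y : 'rV[R]_d.+1) (r : R), 0 < r ->
    let u t := ((cnorm2 (mxpower (W t) p^-1 *m x)) `^ p)%:E in
    (\int[lebesgue_Rn]_(t in rho_ball rho y (2 * r)) u t <=
     (C (muckenhoupt nrm p (rho_balls rho) W))%:E *
       \int[lebesgue_Rn]_(t in rho_ball rho y r) u t)%E) /\
  (exists C : \bar R -> R, forall W : 'rV[R]_d.+1 -> 'M[R[i]]_N.+1,
    matrix_weight W -> matrix_Ap nrm p (rho_balls rho) W ->
    forall (x : 'rV[R]_d.+1) (r : R), 0 < r ->
    (\int[lebesgue_Rn]_(t in rho_ball rho x (2 * r)) (nrm (W t))%:E <=
     (C (muckenhoupt nrm p (rho_balls rho) W))%:E *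
       \int[lebesgue_Rn]_(t in rho_ball rho x r) (nrm (W t))%:E)%E) /\
  (1 < p ->
    exists C : \bar R -> R, forall W : 'rV[R]_d.+1 -> 'M[R[i]]_N.+1,
    matrix_weight W -> matrix_Ap nrm p (rho_balls rho) W ->
    forall x : 'rV[R]_d.+1, posdefmx (W x) ->
    forall (y : 'rV[R]_d.+1) (r : R), 0 < r ->
    let v t := ((weight_kernel nrm p W x t) `^ conj_exponent p)%:E in
    (\int[lebesgue_Rn]_(t in rho_ball rho y (2 * r)) v t <=
     (C (muckenhoupt nrm p (rho_balls rho) W))%:E *
       \int[lebesgue_Rn]_(t in rho_ball rho y r) v t)%E).
Proof.
have [c1 c1_gt0 nrm_le] := matrix_norm_le_entry_norm nrm_norm.
have [c2 c2_gt0 le_nrm] := entry_norm_le_matrix_norm nrm_norm.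
have nrm0 A : 0 <= nrm A by exact: matrix_norm_ge0.
have c2_ge0 := ltW c2_gt0.
split; [|split].
- have c0 : 0 < c2 * N.+1%:R by rewrite mulr_gt0.
  have [C C0 HC] := kernel_doubling rho_pm nrm_norm p_gt0 c0.
  exists C => W Wweight WAp x y r r0 /=.
  have [Z [mZ Z0 posZ mW]] := matrix_weight_regular Wweight.
  apply: (HC W WAp Z (fun t => cnorm2 (mxpower (W t) p^-1 *m x)) mZ Z0 _ _ _ y r r0).
  + by move=> t; exact: sqrtr_ge0.
  + apply: measurable_cnorm2; apply: mx_measurableM; last exact: mx_measurable_cst.
    exact: measurable_mxpower.
  + by move=> s t Zs Zt; apply: cnorm2_power_le_kernel => //; exact: posZ.
- set K : R := (N.+1 * N.+1 * N.+1)%:R `^ p^-1 * c2 * (N.+1 * N.+1 * N.+1)%:R.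
  have K0 : 0 < K by rewrite !mulr_gt0// powR_gt0.
  have [C C0 HC] := kernel_doubling rho_pm nrm_norm p_gt0 K0.
  exists (fun m => c1 * C m * c2) => W Wweight WAp y r r0.
  have [Z [mZ Z0 posZ mW]] := matrix_weight_regular Wweight.
  have powE t : (entry_norm (W t) `^ p^-1) `^ p = entry_norm (W t).
    by rewrite -powRrM mulVf ?gt_eqF// powRr1 ?entry_norm_ge0.
  apply: (@comparable_doubling _ (lebesgue_space R d) R lebesgue_Rn _ _
    (fun t => nrm (W t)) (fun t => (entry_norm (W t) `^ p^-1) `^ p)) => //.
  + exact: ltW.
  + by move=> t; exact: powR_ge0.
  + by move=> t; rewrite powE.
  + by move=> t; rewrite powE.
  apply: (HC W WAp Z (fun t => entry_norm (W t) `^ p^-1) mZ Z0 _ _ _ y r r0).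
  + by move=> t; exact: powR_ge0.
  + apply: (measurableT_comp (measurable_powR p^-1)).
    exact: measurable_entry_norm.
  + move=> s t Zs Zt; apply: entry_norm_weight_le_kernel => //; exact: posZ.
- move=> p1; have [C C0 HC] := dual_kernel_doubling rho_pm nrm_norm p_gt0 c2_gt0 p1.
  set q := conj_exponent p.
  exists (fun m => c1 `^ q * C m * c2 `^ q) => W Wweight WAp x Wx y r r0 /=.
  have [Z [mZ Z0 posZ mW]] := matrix_weight_regular Wweight.
  pose g t := entry_norm (mxpower (W x) p^-1 *m mxpower (W t) (- p^-1)).
  have g0 t : 0 <= g t by exact: entry_norm_ge0.
  have q0 : 0 <= q by rewrite invr_ge0 subr_ge0 invf_le1// ltW.
  have leX a b c : 0 <= a -> 0 <= b -> 0 <= c -> a <= b * c -> a `^ q <= b `^ q * c `^ q.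
    move=> a0 b0 cc abc; rewrite -powRM//.
    by apply: ge0_ler_powR; rewrite ?nnegrE// mulr_ge0.
  apply: (@comparable_doubling _ (lebesgue_space R d) R lebesgue_Rn _ _
    (fun t => weight_kernel nrm p W x t `^ q) (fun t => g t `^ q)).
  + exact: powR_ge0.
  + exact: powR_ge0.
  + exact: C0.
  + by move=> t; exact: powR_ge0.
  + by move=> t; exact: powR_ge0.
  + by move=> t; apply: leX; [exact: nrm0|exact: ltW|exact: g0|exact: nrm_le].
  + by move=> t; apply: leX; [exact: g0|exact: ltW|exact: nrm0|exact: le_nrm].
  apply: (HC W WAp Z g mZ Z0 g0 _ _ y r r0).
  + apply: measurable_entry_norm; apply: mx_measurableM; first exact: mx_measurable_cst.
    exact: measurable_mxpower.
  + by move=> s t Zs Zt; apply: (entry_norm_dual_le_kernel le_nrm); exact: posZ.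
Qed.
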